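(* Let $\beta>0$, let $\mathbf P_{\beta,2}=(\mathsf{Comp}_2)_*\mathsf{Sine}_\beta$, where $\mathsf{Comp}_2\gamma$ is the image of the configuration $\gamma$ under $x\mapsto x/2$, and put $$\mathbf P_\beta^{\mathrm{mix}}=\tfrac12\delta_\varnothing+\tfrac12\mathbf P_{\beta,2},$$ where $\delta_\varnothing$ is the point mass at the empty configuration. Then $\mathbf P_\beta^{\mathrm{mix}}$ is stationary, is supported on simple configurations, has intensity one, satisfies the canonical $\beta$-DLR equations, and $$\mathbf P_\beta^{\mathrm{mix}}\ne\mathsf{Sine}_\beta,\qquad \mathcal W^{\mathrm{div}}(\mathbf P_\beta^{\mathrm{mix}})=+\infty.$$
   Context: **Configurations.** $\mathrm{Conf}(\mathbb R)$ is the space of locally finite nonnegative-integer-valued Radon measures on $\mathbb R$ with the vague topology and its Borel $\sigma$-field. For Borel $A\subset\mathbb R$, $\gamma_A$ is the restriction of $\gamma$ to $A$, $\mathrm{Conf}(A)=\{\gamma:\gamma(A^c)=0\}$, and $\mathrm{Conf}_n(A)=\{\eta\in\mathrm{Conf}(A):\eta(A)=n\}$. $\gamma$ is simple if $\gamma(\{x\})\le1$ for all $x$. $(\theta_t\gamma)(A)=\gamma(A+t)$. A point process is a Borel probability measure $\mathbf P$ on $\mathrm{Conf}(\mathbb R)$, stationary if $\mathbf P\circ\theta_t^{-1}=\mathbf P$ for all $t$; $\mathsf C(\gamma)=\gamma$ is the canonical configuration; $\mathbf P$ has intensity $\lambda$ if $\mathbb E_{\mathbf P}[\mathsf C(A)]=\lambda|A|$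 for bounded Borel $A$. $\mathsf g(x)=-\log|x|$ for $x\ne0$, $\mathsf g(0)=0$; $\Delta=\{(x,x)\}$. For bounded Borel $\Lambda$ with $|\Lambda|>0$, $\mathrm{Bin}_{n,\Lambda}$ is the law of $\sum_{j=1}^n\delta_{U_j}$ with $U_j$ i.i.d. uniform on $\Lambda$; $\mathrm{Bin}_{0,\Lambda}=\delta_\varnothing$. **The process $\mathsf{Sine}_\beta$.** If $(\theta_1,\dots,\theta_N)\in[-\pi,\pi)^N$ has density proportional to $\prod_{j<k}|e^{i\theta_j}-e^{i\theta_k}|^\beta$, then $\mathsf{Sine}_\beta$ is the weak limit (in law on $\mathrm{Conf}(\mathbb R)$, vague topology) of $\sum_{j=1}^N\delta_{N\theta_j/(2\pi)}$ as $N\to\infty$. Known facts: $\mathsf{Sine}_\beta$ is stationary of intensity one, satisfies the canonical $\beta$-DLR equations below, and $\mathcal W^{\mathrm{div}}(\mathsf{Sine}_\beta)<\infty$. **Canonical $\beta$-DLR equations.** For integers $p\ge1$ put $\Lambda_p=[-p/2,p/2]$. Let $\Lambda$ be bounded Borel with $|\Lambda|>0$, $\gamma\in\mathrm{Conf}(\mathbb R)$, $n=\gamma(\Lambda)$, $\eta\in\mathrm{Conf}_n(\Lambda)$. Put $\mathsf H_\Lambda(\eta)=\frac12\iint_{\Lambda^2\setminus\Delta}\mathsf g(x-y)\,d\eta(x)d\eta(y)$ if $\eta$ is simple and $+\infty$ otherwise, and, when $\Lambda\subset\Lambda_p$, $\mathsf M_{\Lambda,\Lambda_p}(\eta,\gamma)=\iint_{\Lambda\times(\Lambda_p\setminus\Lambda)}\mathsf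 g(x-y)\,d(\eta-\gamma_\Lambda)(x)\,d\gamma(y)$. $\gamma$ is $(\beta,\Lambda)$-admissible if there is a finite function $\mathsf M_{\Lambda,\mathbb R}(\cdot,\gamma)$ on $\mathrm{Conf}_n(\Lambda)$ with $\lim_{p\to\infty,\,p\in\mathbb N}\sup_{\eta\in\mathrm{Conf}_n(\Lambda)}|\mathsf M_{\Lambda,\Lambda_p}(\eta,\gamma)-\mathsf M_{\Lambda,\mathbb R}(\eta,\gamma)|=0$ and $0<Z^\beta_{\Lambda,\mathbb R}(\gamma):=\int e^{-\beta(\mathsf H_\Lambda(\eta)+\mathsf M_{\Lambda,\mathbb R}(\eta,\gamma))}\mathrm{Bin}_{n,\Lambda}(d\eta)<\infty$. For admissible $\gamma$ put $\mathsf G^\beta_{\Lambda,\mathbb R}(d\eta,\gamma)=Z^\beta_{\Lambda,\mathbb R}(\gamma)^{-1}e^{-\beta(\mathsf H_\Lambda(\eta)+\mathsf M_{\Lambda,\mathbb R}(\eta,\gamma))}\mathrm{Bin}_{n,\Lambda}(d\eta)$. Let $\mathscr F_A=\sigma\{\gamma\mapsto\gamma(B):B\subset A\text{ bounded Borel}\}$ and $\mathscr F_\Lambda^{\mathrm{can}}=\mathscr F_{\Lambda^c}\vee\sigma(\gamma\mapsto\gamma(\Lambda))$. $\mathbf P$ satisfies the canonical $\beta$-DLR equations if for every bounded Borel $\Lambda$ with $|\Lambda|>0$ there is a universally measurable set of full $\mathbf P$-measure consisting of $(\beta,\Lambda)$-admissible configurations such that the kernel $\mathsf G^\beta_{\Lambda,\mathbb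 R}$, defined on that set, has a probability-kernel extension, measurable for the $\mathbf P$-completion of $\mathscr F^{\mathrm{can}}_\Lambda$ and denoted the same way, with $\int F\,d\mathbf P=\int\int_{\mathrm{Conf}(\Lambda)}F(\eta+\gamma_{\Lambda^c})\,\mathsf G^\beta_{\Lambda,\mathbb R}(d\eta,\gamma)\,\mathbf P(d\gamma)$ for every bounded Borel $F$. **Electric energy.** Fix $1<q<2$. A field $E\in L^{q}_{\mathrm{loc}}(\mathbb R^2;\mathbb R^2)$ is divergence-compatible with $\gamma$ if $-\operatorname{div}E=2\pi(\gamma-\mathrm{Leb})$ in the sense of distributions on $\mathbb R^2$, where $\gamma$ and $\mathrm{Leb}$ (Lebesgue measure on $\mathbb R$) are embedded in $\mathbb R\times\{0\}$. For $\varepsilon\in(0,1)$ put $f_\varepsilon(X)=(\log(\varepsilon/|X|))^+$ and $E_\varepsilon=E-\int_{\mathbb R}\nabla f_\varepsilon(\cdot-(x,0))\,d\gamma(x)$. Define $\widetilde{\mathcal W}^{\mathrm{div}}(\gamma)=\inf_{E}\lim_{\varepsilon\downarrow0}\limsup_{R\to\infty}\big(\frac1{2R}\frac1{2\pi}\int_{[-R,R]\times\mathbb R}|E_\varepsilon|^2\,dX+\log\varepsilon\big)$, the infimum over all $E$ divergence-compatible with $\gamma$ ($+\infty$ if there is none); it is bounded below by a universal constant. For stationary $\mathbf P$, $\mathcal W^{\mathrm{div}}(\mathbf P)=\mathbb E_{\mathbf P}[\widetilde{\mathcal W}^{\mathrm{div}}(\mathsf C)]$. *)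

(* Defs.v *)
From HB Require Import structures.
From mathcomp Require Import all_boot all_order all_algebra.
From mathcomp Require Import all_classical all_reals all_analysis.
From mathcomp Require Import measurable_realfun.
Set Implicit Arguments.
Unset Strict Implicit.
Unset Printing Implicit Defensive.
Import Order.TTheory GRing.Theory Num.Theory.
Import numFieldNormedType.Exports.
Local Open Scope classical_set_scope.
Local Open Scope ring_scope.

Section iid.
Context d (T : measurableType d) {R : realType}.
Variable P : probability T R.

Definition consT n (x : T * n.-tuple T) : n.+1.-tuple T :=
  [the n.+1.-tuple T of x.1 :: x.2].

Lemma measurable_consT n : measurable_fun setT (@consT n).
Proof. by apply: measurable_cons; [exact: measurable_fst|exact: measurable_snd]. Qed.

HB.instance Definition _ n :=
  isMeasurableFun.Build _ _ _ _ (@consT n) (@measurable_consT n).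

Fixpoint iid n : probability (n.-tuple T) R :=
  match n with
  | 0%N => dirac [tuple]
  | m.+1 => distribution (P \x iid m)%E (@consT m)
  end.
End iid.

Section configurations.
Context {R : realType}.

(* Values on bounded Borel sets are integers (hence finite); integrality on
   unbounded Borel sets, up to +oo, follows by monotone continuity.  A library
   measure also carries (meaningless) values on non-Borel sets: two elements of
   Conf that agree on Borel sets represent the same configuration.  They are
   topologically indistinguishable for the vague topology, hence belong to the
   same Borel sets of Conf, and nothing below can tell them apart. *)
Record Conf := MkConf {
  cmeas :> {measure set (measurableTypeR R) -> \bar R} ;
  confP : forall A : set (measurableTypeR R), measurable A ->
    bounded_set (A : set R) ->
    exists n : nat, cmeas A = n%:R%:E }.

Record Cc := MkCc {
  cfun :> R -> R ;
  Cc_cont : continuous cfun ;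
  Cc_supp : compact (closure [set x | cfun x != 0]) }.

HB.instance Definition _ := gen_eqMixin Conf.
HB.instance Definition _ := gen_choiceMixin Conf.

Fact empty_confP (A : set (measurableTypeR R)) : measurable A ->
  bounded_set (A : set R) ->
  exists n : nat, @mzero _ (measurableTypeR R) R A = n%:R%:E.
Proof. by exists 0%N. Qed.
Definition emptyconf : Conf := MkConf empty_confP.
HB.instance Definition _ := isPointed.Build Conf emptyconf.

(* The vague topology is the initial topology of gamma |-> \int f dgamma for
   f ranging over continuous functions with compact support. *)
Definition vague_eval (gamma : Conf) : {ptws Cc -> R} :=
  fun f => (\int[gamma]_x f x)%R.
HB.instance Definition _ := Topological.copy Conf (initial_topology vague_eval).

Fact dirac_confP (x : R) (A : set (measurableTypeR R)) : measurable A ->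
  bounded_set (A : set R) ->
  exists n : nat, @dirac _ (measurableTypeR R) x R A = n%:R%:E.
Proof. by move=> _ _; rewrite diracE; exists (x \in A). Qed.
Definition diracconf x := MkConf (dirac_confP x).

Fact add_confP (g1 g2 : Conf) (A : set (measurableTypeR R)) : measurable A ->
  bounded_set (A : set R) ->
  exists n : nat, measure_add g1 g2 A = n%:R%:E.
Proof.
move=> mA bA; have [n1 e1] := confP g1 mA bA; have [n2 e2] := confP g2 mA bA.
by exists (n1 + n2)%N; rewrite measure_addE natrD EFinD; congr (_ + _)%E.
Qed.
Definition addconf g1 g2 := MkConf (@add_confP g1 g2).

Fact rest_confP (D : set (measurableTypeR R)) (mD : measurable D) (g : Conf)
  (A : set (measurableTypeR R)) : measurable A ->
  bounded_set (A : set R) ->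
  exists n : nat, mrestr g mD A = n%:R%:E.
Proof.
move=> mA bA; apply: confP; first exact: measurableI.
by apply: sub_boundedr bA => P AP x [] /AP.
Qed.
Definition restconf D (mD : measurable D) g := MkConf (@rest_confP D mD g).

Section image.
Variables (f : measurableTypeR R -> measurableTypeR R).
Hypothesis mf : measurable_fun setT f.
Hypothesis bf : forall A : set R, bounded_set A -> bounded_set (f @^-1` A : set R).

(* Same function as pushforward g f, with its measure structure attached. *)
Let push (g : Conf) : {measure set (measurableTypeR R) -> \bar R}.
Proof.
by unshelve refine (pushforward g f : {measure set _ -> \bar R}); exact: mf.
Defined.

Fact map_confP (g : Conf) (A : set (measurableTypeR R)) : measurable A ->
  bounded_set (A : set R) -> exists n : nat, push g A = n%:R%:E.
Proof.
move=> mA bA; apply: confP; last exact: bf.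
by rewrite -[X in measurable X]setTI; exact: mf.
Qed.
Definition mapconf (g : Conf) : Conf := MkConf (map_confP g).

Lemma mapconfE (g : Conf) A : mapconf g A = g (f @^-1` A).
Proof. by []. Qed.
End image.

Lemma bounded_setE (A : set R) :
  bounded_set A <-> exists M : R, forall x, A x -> `|x| <= M.
Proof.
split=> [/pinfty_ex_gt0 [M _ H]|[M H]]; first by exists M => x /H.
exists M; split; first exact: num_real.
by move=> N MN x /H /le_trans; apply; exact: ltW.
Qed.

Lemma measurable_shift (t : R) :
  measurable_fun setT ((fun x => x - t) : measurableTypeR R -> measurableTypeR R).
Proof. by apply: continuous_measurable_fun => x; apply: cvgB; [exact: cvg_id|exact: cvg_cst]. Qed.

Lemma bounded_shift (t : R) (A : set R) :
  bounded_set A -> bounded_set ((fun x => x - t) @^-1` A : set R).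
Proof.
move=> /bounded_setE[M AM]; apply/bounded_setE; exists (M + `|t|) => x /AM.
by move=> xM; rewrite -[x](subrK t) (le_trans (ler_normD _ _))// lerD2r.
Qed.

(* (shiftconf t gamma) A = gamma (A + t): points are moved by - t. *)
Definition shiftconf (t : R) : Conf -> Conf :=
  mapconf (measurable_shift t) (@bounded_shift t).

Lemma measurable_half :
  measurable_fun setT ((fun x => x / 2) : measurableTypeR R -> measurableTypeR R).
Proof. by apply: continuous_measurable_fun => x; apply: cvgM; [exact: cvg_id|exact: cvg_cst]. Qed.

Lemma bounded_half (A : set R) :
  bounded_set A -> bounded_set ((fun x => x / 2) @^-1` A : set R).
Proof.
move=> /bounded_setE[M AM]; apply/bounded_setE; exists (M * 2) => x /AM.
by rewrite normrM (ger0_norm (_ : 0 <= 2^-1))// ler_pdivrMr.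
Qed.

Definition comp2 : Conf -> Conf := mapconf measurable_half bounded_half.

Definition conf_of_seq (s : seq R) : Conf :=
  foldr (fun x g => addconf (diracconf x) g) emptyconf s.


Lemma Cc_measurable (f : Cc) : measurable_fun setT (f : measurableTypeR R -> R).
Proof. by apply: continuous_measurable_fun; exact: Cc_cont. Qed.

Lemma Cc_supportE (f : Cc) : exists M : R, forall x, M < `|x| -> f x = 0.
Proof.
have /bounded_setE[M fM] := compact_bounded (@Cc_supp f).
exists M => x Mx; apply/eqP/negP => /negP fx0.
have : `|x| <= M by apply: fM; exact: subset_closure.
by rewrite leNgt Mx.
Qed.

Lemma Cc_boundedE (f : Cc) : exists K : R, forall x, `|f x| <= K.
Proof.
have [M fM] := Cc_supportE f.
have cf : compact (f @` `[- M, M]).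
  apply: continuous_compact; last exact: segment_compact.
  by apply: continuous_subspaceT; exact: Cc_cont.
have /bounded_setE[K fK] := compact_bounded cf.
exists (Num.max K 0) => x; rewrite le_max.
have [/fM ->|xM] := ltP M `|x|; first by rewrite normr0 lexx orbT.
by apply/orP; left; apply: fK; exists x => //=; rewrite in_itv/= -ler_norml.
Qed.

Lemma Cc_integrable (f : Cc) (g : Conf) : g.-integrable setT (EFin \o f).
Proof.
have [M fM] := Cc_supportE f; have [K fK] := Cc_boundedE f.
set D := (`[- M, M]%classic : set (measurableTypeR R)).
have mD : measurable D by exact: measurable_itv.
have -> : EFin \o f = ((EFin \o f) \_ D).
  apply/funext => x; rewrite patchE; case: ifPn => //.
  move=> /negP; rewrite inE /D/= in_itv/= -ler_norml => /negP; rewrite -ltNge.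
  by move=> /fM /= ->.
rewrite -integrable_mkcond//; apply: measurable_bounded_integrable => //.
- have [|n ->] := @confP g D mD; last by rewrite ltry.
  by apply/bounded_setE; exists M => x; rewrite /D/= in_itv/= -ler_norml.
- by apply: measurable_funTS; exact: Cc_measurable.
- exists K; split; first exact: num_real.
  by move=> N KN x _; exact: le_trans (fK x) (ltW KN).
Qed.

Lemma continuous_into_conf (X : topologicalType) (h : X -> Conf) :
  (forall f : Cc, continuous (fun x => (\int[h x]_y f y)%R : R)) -> continuous h.
Proof.
move=> hc; apply: (@continuous_comp_initial _ _ _ vague_eval) => x.
by apply/cvg_sup => f; apply: (@continuous_comp_initial _ _ _ (fun k : Cc -> R => k f)); exact: hc.
Qed.

Lemma Rint_diracconf (f : Cc) x : (\int[diracconf x]_y f y = f x)%R.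
Proof.
rewrite /Rintegral integral_dirac//; last by apply/measurable_EFinP; exact: Cc_measurable.
by rewrite diracT mul1e.
Qed.

Lemma Rint_addconf (f : Cc) g1 g2 :
  (\int[addconf g1 g2]_y f y = \int[g1]_y f y + \int[g2]_y f y)%R.
Proof.
have i1 := Cc_integrable f g1; have i2 := Cc_integrable f g2.
rewrite /Rintegral integral_measure_add//.
by rewrite fineD// integrable_fin_num.
Qed.

Lemma Rint_emptyconf (f : Cc) : (\int[emptyconf]_y f y = 0)%R.
Proof. by rewrite /Rintegral integral_measure_zero. Qed.

Lemma Rint_conf_of_seq (f : Cc) s :
  (\int[conf_of_seq s]_y f y = \sum_(x <- s) f x)%R.
Proof.
elim: s => [|x s IH]; first by rewrite big_nil Rint_emptyconf.
by rewrite big_cons -IH -(Rint_diracconf f x) -Rint_addconf.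
Qed.

Fact comp2_cont (f : Cc) : continuous ((fun x => f (x / 2)) : R -> R).
Proof.
move=> x; apply: (@cvg_comp _ _ _ (fun x : R => x / 2) f _ (nbhs (x / 2))); last exact: Cc_cont.
by apply: cvgM; [exact: cvg_id|exact: cvg_cst].
Qed.

Fact comp2_supp (f : Cc) : compact (closure [set x : R | f (x / 2) != 0]).
Proof.
have [M fM] := Cc_supportE f.
apply: (subclosed_compact _ (@segment_compact _ (- (M * 2)) (M * 2))).
  exact: closed_closure.
have cl : closed `[- (M * 2), M * 2] by exact: interval_closed.
rewrite [X in _ `<=` X]((closure_id _).1 cl); apply: closure_subset => x /= fx.
rewrite in_itv/= -ler_norml leNgt; apply/negP => Mx.
move: fx; rewrite fM ?eqxx// normrM (ger0_norm (_ : 0 <= 2^-1))//.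
by rewrite ltr_pdivlMr.
Qed.

Lemma continuous_Rint (f : Cc) : continuous (fun g : Conf => (\int[g]_y f y)%R : R).
Proof.
move=> g; have := @initial_continuous _ _ vague_eval g.
move/cvg_sup => /(_ _ f) h; have := @initial_continuous _ _ (fun k : Cc -> R => k f) (vague_eval g).
move=> h' A /h' /h k; apply: k.
exact: (@fmap_filter _ _ _ _ (nbhs_filter g)).
Qed.

Lemma continuous_comp2 : continuous comp2.
Proof.
apply: continuous_into_conf => f.
pose f2 := MkCc (@comp2_cont f) (@comp2_supp f).
have E (g : Conf) : (\int[comp2 g]_y f y)%R = (\int[g]_y f2 y)%R.
  rewrite /Rintegral/= (@integral_pushforward _ _ _ _ _ _ measurable_half)//.
  - by apply/measurable_EFinP; exact: Cc_measurable.
  - by rewrite preimage_setT; exact: (Cc_integrable f2 g).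
have -> : (fun g : Conf => (\int[comp2 g]_y f y)%R) = (fun g => (\int[g]_y f2 y)%R).
  by apply/funext.
exact: continuous_Rint.
Qed.
(* Borel sigma-field of the vague topology. *)
HB.instance Definition _ := Measurable.copy Conf (g_sigma_algebraType (@open Conf)).

Lemma measurable_comp2 : measurable_fun setT comp2.
Proof.
apply: (@measurability _ _ _ _ _ _ (@open Conf)) => // _ [U oU <-].
rewrite setTI; apply: sub_sigma_algebra.
by move/continuousP : continuous_comp2; exact.
Qed.
HB.instance Definition _ := isMeasurableFun.Build _ _ _ _ comp2 measurable_comp2.

Lemma continuous_conf_of_row n :
  continuous (fun v : 'rV[R]_n => conf_of_seq [seq v ord0 i | i <- enum 'I_n]).
Proof.
apply: continuous_into_conf => f.
have -> : (fun v : 'rV[R]_n =>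
    (\int[conf_of_seq [seq v ord0 i | i <- enum 'I_n]]_y f y)%R : R) =
    (fun v => \sum_(i <- enum 'I_n) f (v ord0 i)).
  by apply/funext => v; rewrite Rint_conf_of_seq big_map.
apply: continuous_big => [|i _ v]; first exact: add_continuous.
apply: (@cvg_comp _ _ _ (fun v : 'rV[R]_n => v ord0 i) f _ (nbhs (v ord0 i))).
  exact: coord_continuous.
exact: Cc_cont.
Qed.

Lemma measurable_conf_of_tuple n :
  measurable_fun setT (fun t : n.-tuple (measurableTypeR R) => conf_of_seq t).
Proof.
apply: (@measurability _ _ _ _ _ _ (@open Conf)) => // _ [U oU <-].
rewrite setTI.
pose row (t : n.-tuple R) : 'rV[R]_n := \row_i tnth t i.
pose W := (fun v : 'rV[R]_n => conf_of_seq [seq v ord0 i | i <- enum 'I_n]) @^-1` U.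
have oW : open W by move/continuousP : (@continuous_conf_of_row n); exact.
have rowE (t : n.-tuple R) : conf_of_seq t = conf_of_seq [seq row t ord0 i | i <- enum 'I_n].
  congr conf_of_seq; rewrite -[in LHS](map_tnth_enum t).
  by apply: eq_map => i; rewrite mxE.
pose B (k : n.-tuple rat * nat) : set (n.-tuple (measurableTypeR R)) :=
  [set t | forall i, `|tnth t i - ratr (tnth k.1 i)| < k.2.+1%:R^-1].
pose B' k := [set t | B k t /\ B k `<=` [set t | W (row t)]].
rewrite (_ : _ @^-1` _ = \bigcup_k B' k); last first.
  apply/seteqP; split => [t /= Ut|t [k _ [Bt Bk]]]; last first.
    by rewrite /= rowE; exact: (Bk _ Bt).
  have Wt : W (row t) by rewrite /W/= -rowE.
  move: oW; rewrite openE => /(_ _ Wt)/nbhs_ballP[e/= e0 eW].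
  have [m me] : exists m : nat, m.+1%:R^-1 < e / 2.
    have e20 : 0 < e / 2 by rewrite divr_gt0.
    have [m _ /(_ m)] := near_infty_natSinv_lt (PosNum e20).
    by move=> /(_ (leqnn m)) ?; exists m.
  have qP i : exists q : rat, `|tnth t i - ratr q| < m.+1%:R^-1.
    have : tnth t i - m.+1%:R^-1 < tnth t i + m.+1%:R^-1.
      by rewrite ltrBlDr -addrA ltrDl addr_gt0// invr_gt0.
    move=> /rat_in_itvoo[q]; rewrite in_itv/= => /andP[h1 h2]; exists q.
    by rewrite ltr_distlC h1 h2.
  have [q qE] := choice qP.
  exists ([tuple q i | i < n], m) => //; split.
    by move=> i /=; rewrite tnth_mktuple.
  move=> s /= Bs; apply: eW; rewrite /ball/= /mx_ball; split => // i j.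
  rewrite !mxE /ball/=.
  have := Bs j; rewrite /= tnth_mktuple => sq.
  rewrite (splitr e) (le_lt_trans (ler_distD (ratr (q j)) _ _))//.
  by rewrite ltrD// (lt_trans _ me)// distrC.
apply: countable_bigcupT_measurable => // k.
have [Bk|nBk] := pselect (B k `<=` [set t | W (row t)]); last first.
  rewrite (_ : B' k = set0); first exact: measurable0.
  by apply/seteqP; split => // t [].
rewrite (_ : B' k = \bigcap_(i in [set: 'I_n]) [set t | `|tnth t i - ratr (tnth k.1 i)| < k.2.+1%:R^-1]); last first.
  by apply/seteqP; split => [t [Bt _] i _|t Bt]; [exact: Bt|split => // i; exact: Bt].
apply: fin_bigcap_measurable => // i _.
set q : R := ratr _; set r : R := _^-1.
rewrite (_ : [set t | _] = (@tnth _ (measurableTypeR R) ^~ i) @^-1` `]q - r, q + r[).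
  rewrite -[X in measurable X]setTI; apply: measurable_tnth => //.
by apply/seteqP; split => t /=; rewrite in_itv/= ltr_distl.
Qed.


Definition conf_of_tuple n (t : n.-tuple (measurableTypeR R)) : Conf := conf_of_seq t.

HB.instance Definition _ n := isMeasurableFun.Build _ _ _ _
  (@conf_of_tuple n) (@measurable_conf_of_tuple n).

End configurations.
Arguments Conf R : clear implicits.
Arguments Cc R : clear implicits.

Section point_processes.
Context {R : realType}.
Local Notation leb := (@lebesgue_measure R).
Implicit Types (P : probability (Conf R) R) (gamma eta : Conf R).
Implicit Types (Lambda : set (measurableTypeR R)).

Definition stationary P := forall (t : R) (A : set (Conf R)), measurable A ->
  P (shiftconf t @^-1` A) = P A.

Definition has_intensity (lambda : R) P :=
  forall A : set (measurableTypeR R), measurable A -> bounded_set (A : set R) ->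
  (\int[P]_gamma gamma A = lambda%:E * leb A)%E.

Definition simple_conf gamma := forall x : R, (gamma [set x] <= 1)%E.

Definition compressed2 P : probability (Conf R) R := distribution P comp2.

Definition mix_mass (P : probability (Conf R) R) : set (Conf R) -> \bar R :=
  measure_add (mscale (2^-1)%:nng (dirac emptyconf)) (mscale (2^-1)%:nng P).
HB.instance Definition _ P := Measure.on (mix_mass P).

Let mix_mass_setT P : mix_mass P setT = 1%E.
Proof.
transitivity ((2^-1)%:E * @dirac _ (Conf R) emptyconf R setT
              + (2^-1)%:E * P setT)%E; first exact: measure_addE.
by rewrite diracT probability_setT !mule1 -EFinD [in RHS](splitr 1) div1r.
Qed.
HB.instance Definition _ P :=
  Measure_isProbability.Build _ _ _ (mix_mass P) (mix_mass_setT P).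

Definition mix P : probability (Conf R) R := mix_mass P.

(* The default value dirac 0 is used by mnormalize only when Lambda has measure
   0 or +oo. *)
Definition unif Lambda (mL : measurable Lambda) : probability (measurableTypeR R) R :=
  mnormalize (mrestr leb mL) (@dirac _ (measurableTypeR R) (0 : R) R).

Definition Bin n Lambda (mL : measurable Lambda) : probability (Conf R) R :=
  distribution (iid (unif mL) n) (@conf_of_tuple R n).

End point_processes.

Section sine.
Context {R : realType}.

Definition torus : set (measurableTypeR R) := `[- pi, pi[.
Lemma measurable_torus : measurable torus.
Proof. exact: measurable_itv. Qed.

(* chord a b = |e^(ia) - e^(ib)| *)
Definition chord (a b : R) : R :=
  Num.sqrt ((cos a - cos b) ^+ 2 + (sin a - sin b) ^+ 2).

Definition cbe_density (beta : R) N (theta : N.-tuple R) : R :=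
  \prod_(j < N) \prod_(k < N | (j < k)%N)
    (chord (tnth theta j) (tnth theta k) `^ beta).

Definition cbe_conf N (theta : N.-tuple R) : Conf R :=
  conf_of_seq [seq N%:R * x / (2 * pi) | x <- theta].

(* Expectation of F under the law of the rescaled circular beta-ensemble; the
   base measure is normalized Lebesgue measure on [-pi, pi[ ^ N, the
   normalization being irrelevant in the quotient. *)
Definition cbe_expectation (beta : R) N (F : Conf R -> R) : R :=
  (\int[iid (unif measurable_torus) N]_theta (F (cbe_conf theta) * cbe_density beta theta))
  / (\int[iid (unif measurable_torus) N]_theta cbe_density beta theta).

Definition is_sine (beta : R) (P : probability (Conf R) R) :=
  forall F : Conf R -> R, continuous F -> bounded_fun F ->
  cbe_expectation beta N F @[N --> \oo] --> \int[P]_gamma F gamma.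

End sine.

Section dlr.
Context {R : realType}.
Implicit Types (P : probability (Conf R) R) (gamma eta : Conf R).
Implicit Types (Lambda : set (measurableTypeR R)).

Definition logpot (x : R) : R := if x == 0 then 0 else - ln `|x|.

Definition box (p : nat) : set (measurableTypeR R) := `[- (p%:R / 2), p%:R / 2].

(* gamma Lambda as a natural number, for bounded Borel Lambda *)
Definition npts gamma Lambda : nat := Num.truncn (fine (gamma Lambda)).

Definition conf_in (A : set (measurableTypeR R)) : set (Conf R) :=
  [set eta | eta (~` A) = 0%E].

Definition conf_n n (A : set (measurableTypeR R)) : set (Conf R) :=
  [set eta | conf_in A eta /\ eta A = n%:R%:E].

(* Lambda^2 minus the diagonal is described by its sections Lambda `\ x; for
   bounded Lambda all integrals in Hen and Mov are finite sums. *)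
Definition Hen Lambda eta : \bar R :=
  if `[< simple_conf eta >] then
    (2^-1 * \int[eta]_(x in Lambda)
       (\int[eta]_(y in Lambda `\ x) logpot (x - y))%R)%:E
  else +oo%E.

Section window.
Variables (Lambda : set (measurableTypeR R)) (mL : measurable Lambda).

Definition Mov (p : nat) eta gamma : R :=
  \int[eta]_(x in Lambda)
     (\int[gamma]_(y in box p `\` Lambda) logpot (x - y))%R
  - \int[restconf mL gamma]_(x in Lambda)
     (\int[gamma]_(y in box p `\` Lambda) logpot (x - y))%R.

(* M is only constrained on conf_n (npts gamma Lambda) Lambda, the only place
   where it is used below. *)
Definition is_Mov_lim gamma (M : Conf R -> R) :=
  (ereal_sup [set (`|Mov p eta gamma - M eta|)%:E
    | eta in conf_n (npts gamma Lambda) Lambda] @[p --> \oo] --> 0)%E.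

Definition boltzmann (beta : R) (M : Conf R -> R) eta : \bar R :=
  expeR (- (beta%:E * (Hen Lambda eta + (M eta)%:E)))%E.

Definition partition_fun beta M n : \bar R :=
  (\int[Bin n mL]_(eta in conf_n n Lambda) boltzmann beta M eta)%E.

Definition admissible beta gamma := exists M : Conf R -> R,
  is_Mov_lim gamma M /\ (0 < partition_fun beta M (npts gamma Lambda) < +oo)%E.

Definition gibbs beta M n (B : set (Conf R)) : \bar R :=
  ((fine (partition_fun beta M n))^-1%:E *
   \int[Bin n mL]_(eta in conf_n n Lambda `&` B) boltzmann beta M eta)%E.

Definition count_events (A : set (measurableTypeR R)) : set (set (Conf R)) :=
  [set C | exists (B : set (measurableTypeR R)) (Y : set (\bar R)),
    [/\ measurable B, bounded_set (B : set R), B `<=` A, measurable Y &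
        C = [set gamma : Conf R | Y (gamma B)]]].

Definition Fcan : set (set (Conf R)) :=
  <<s count_events (~` Lambda) `|`
      [set C | exists2 Y : set (\bar R), measurable Y &
         C = [set gamma : Conf R | Y (gamma Lambda)]] >>.

End window.

(* Completion, for P, of the sub-sigma-field F. *)
Definition completion (F : set (set (Conf R))) P : set (set (Conf R)) :=
  [set A | exists B C, [/\ F B, F C, B `<=` A, A `<=` C & P (C `\` B) = 0%E]].

Definition universally_measurable (A : set (Conf R)) :=
  forall P, completion measurable P A.

(* K is the probability-kernel extension of the Gibbs kernel: K gamma is a
   probability on Conf(Lambda), seen as a probability on Conf(R) that gives
   full mass to conf_in Lambda. *)
Definition canonical_DLR (beta : R) P :=
  forall Lambda (mL : measurable Lambda), bounded_set (Lambda : set R) ->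
  (0 < lebesgue_measure Lambda)%E ->
  exists A : set (Conf R),
  [/\ universally_measurable A, P.-negligible (~` A), A `<=` admissible mL beta &
  exists K : Conf R -> probability (Conf R) R,
  [/\ forall gamma, K gamma (conf_in Lambda) = 1%E,
      forall gamma M, A gamma -> is_Mov_lim mL gamma M ->
        forall B, measurable B -> K gamma B = gibbs mL beta M (npts gamma Lambda) B,
      forall (B : set (Conf R)) (Y : set (\bar R)), measurable B -> measurable Y ->
        completion (Fcan Lambda) P [set gamma | Y (K gamma B)] &
      forall F : Conf R -> R, measurable_fun setT F -> bounded_fun F ->
        (\int[P]_gamma (F gamma)%:E =
         \int[P]_gamma \int[K gamma]_(eta in conf_in Lambda)
           (F (addconf eta (restconf (measurableC mL) gamma)))%:E)%E]].

End dlr.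

Section electric.
Context {R : realType}.
Local Notation leb := (@lebesgue_measure R).
Local Notation leb2 := (leb \x leb)%E.
Local Notation e1 := ((1 : R), (0 : R)).
Local Notation e2 := ((0 : R), (1 : R)).
Implicit Types (P : probability (Conf R) R) (gamma : Conf R).

(* The library norm on R * R is the sup norm. *)
Definition enorm (X : R * R) : R := Num.sqrt (X.1 ^+ 2 + X.2 ^+ 2).

(* phi is of class C^k *)
Fixpoint Ck (k : nat) (phi : R * R -> R) : Prop :=
  continuous phi /\
  match k with
  | 0%N => True
  | m.+1 => [/\ forall X, derivable phi X e1, forall X, derivable phi X e2,
                Ck m (fun X => 'D_e1 phi X) & Ck m (fun X => 'D_e2 phi X)]
  end.

Definition test_function (phi : R * R -> R) :=
  (forall k, Ck k phi) /\ compact (closure [set X | phi X != 0]).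

Definition Lq_loc (q : R) (E : R * R -> R * R) :=
  measurable_fun setT E /\
  forall K : set (R * R), compact K ->
    (\int[leb2]_(X in K) (enorm (E X) `^ q)%:E < +oo)%E.

(* - div E = 2 pi (gamma - Leb), tested against phi: the distribution - div E
   maps phi to \int E . grad phi. *)
Definition div_compatible gamma (E : R * R -> R * R) :=
  forall phi, test_function phi ->
  (\int[leb2]_X ((E X).1 * 'D_e1 phi X + (E X).2 * 'D_e2 phi X))%R =
  2 * pi * (\int[gamma]_x phi (x, 0) - \int[leb]_x phi (x, 0)).

Definition ftrunc (eps : R) (X : R * R) : R := Num.max (ln (eps / enorm X)) 0.

(* E - \int grad ftrunc(. - (x, 0)) dgamma(x); ftrunc fails to be differentiable
   only at 0 and on the circle of radius eps, so that the value of the library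
   derivative there affects a null set only. *)
Definition Etrunc gamma (E : R * R -> R * R) (eps : R) (X : R * R) : R * R :=
  ((E X).1 - \int[gamma]_x 'D_e1 (ftrunc eps) (X - (x, 0)),
   (E X).2 - \int[gamma]_x 'D_e2 (ftrunc eps) (X - (x, 0))).

Definition strip (L : R) : set (R * R) := `[- L, L] `*` setT.

Definition strip_energy gamma E (eps L : R) : \bar R :=
  (((2 * L)^-1 * (2 * pi)^-1)%:E *
    \int[leb2]_(X in strip L) (enorm (Etrunc gamma E eps X) ^+ 2)%:E
  + (ln eps)%:E)%E.

Definition Wdiv_conf (q : R) gamma : \bar R :=
  ereal_inf [set w | exists E : R * R -> R * R,
    [/\ Lq_loc q E, div_compatible gamma E &
        limf_esup (strip_energy gamma E eps) (pinfty_nbhs R)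
          @[eps --> 0^'+] --> w]].

Definition Wdiv (q : R) P : \bar R := (\int[P]_gamma Wdiv_conf q gamma)%E.

End electric.

(* Main.v *)
(* Empty configurations are trivially Gibbsian, and the logarithmic interaction
   is scale invariant up to constants: under x |-> x / 2 the energy of n points
   changes by a function of n and the interaction with the exterior does not
   change at all, because only differences of configurations with the same
   number of points enter it.  The window of index p becomes the window of index
   2p, so limits over windows are inherited as limits along even integers.  Hence
   both components of the mixture satisfy the canonical DLR equations, and the
   number of points being measurable for the canonical sigma-field, so does the
   mixture.  Simplicity follows from the DLR equations themselves, since
   configurations with a multiple point have Gibbs weight zero.

   A field with -div E = -2 pi Leb carries a flux of order L out of [-L, L]; by
   Cauchy-Schwarz on a square of side 2L its energy in the strip |x| <= L is at
   least of order L^2, so the empty configuration has infinite energy.  Therefore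
   Sine_beta, which has finite energy, does not charge it, whereas the mixture
   does. *)
Require Import Defs.
From HB Require Import structures.
From mathcomp Require Import all_boot all_order all_algebra.
From mathcomp Require Import all_classical all_reals all_analysis.
From mathcomp Require Import measurable_realfun.
From mathcomp Require Import ring lra.
Import Order.TTheory GRing.Theory Num.Theory.
Import numFieldNormedType.Exports.
Local Open Scope classical_set_scope.
Local Open Scope ring_scope.
Set Implicit Arguments.
Unset Strict Implicit.
Unset Printing Implicit Defensive.

(** Two measure-theoretic obstacles shape the proof. First, the function M in [is_Mov_lim] carries
    no measurability and the kernels are measurable only for a completion, so many integrands cannot
    be taken Borel. The integral of an arbitrary function is the difference of the lower integrals
    of its two parts. A Borel map transports a lower integral with an inequality only, a Borel
    isomorphism exactly; this is why [comp2] is paired with its Borel inverse [dil2]. Second, a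
    configuration that vanishes on all Borel sets need not equal [emptyconf], so the atom of the
    mixture is handled through the Borel set [null_conf]. The DLR equations of Sine say nothing on
    an exceptional null set, which may contain null configurations, whereas the mixture charges
    them. The finite energy of Sine makes [null_conf] negligible for it, so the kernel may be
    overwritten there by the value that the Gibbs formula forces. The energy thus enters already in
    the proof of the DLR equations, not only in the separation from Sine. *)

(** * Lower integrals *)

(* The library integral of a nonnegative function that is not measurable is its
   lower integral.  The rules below do not assume measurability because the DLR
   equations integrate functions that are only known to be measurable for a
   completion, and the Gibbs kernels involve an arbitrary function M. *)
Section lower_integral.
Context d (T : measurableType d) (R : realType).
Implicit Types (mu : {measure set T -> \bar R}) (f g h : T -> \bar R).
Local Open Scope ereal_scope.

Import HBNNSimple.

Lemma le_lower_integral mu f h : (forall x, 0 <= f x) -> (forall x, f x <= h x) ->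
  \int[mu]_x f x <= \int[mu]_x h x.
Proof.
move=> f0 fh; rewrite !ge0_integralTE//; last by move=> x; exact: le_trans (f0 x) _.
apply: le_ereal_sup => _ [k /= kf <-]; exists k => //= x.
exact: le_trans (kf x) _.
Qed.

(** A sequence of simple minorants whose integrals approach the supremum has a measurable pointwise
    supremum, which attains it. Each rule below is thereby reduced to its measurable case. *)
Lemma measurable_minorant mu f : (forall x, 0 <= f x) ->
  exists g, [/\ measurable_fun setT g, forall x, 0 <= g x, forall x, g x <= f x &
    \int[mu]_x g x = \int[mu]_x f x].
Proof.
move=> f0.
pose S := [set sintegral mu h | h in
  [set h : {nnsfun T >-> R} | forall x, (h x)%:E <= f x]].
have fS : \int[mu]_x f x = ereal_sup S by rewrite ge0_integralTE.
have [|u uS ul] := @ereal_sup_seq R S.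
  by apply/set0P; exists (sintegral mu nnsfun0), nnsfun0.
have hP n : exists h : {nnsfun T >-> R}, (forall x, (h x)%:E <= f x) /\ sintegral mu h = u n.
  by have [h hf hu] := uS n; exists h.
have [h {}hP] := choice hP.
pose g x := esups (fun n => (h n x)%:E) 0%N.
have gge n x : (h n x)%:E <= g x by apply: ereal_sup_ubound; exists n.
have mg : measurable_fun setT g.
  by apply: measurable_fun_esups => n; exact/measurable_EFinP.
have g0 x : 0 <= g x by apply: le_trans (gge 0%N x); rewrite lee_fin.
have gf x : g x <= f x by apply: ge_ereal_sup => _ [n _ <-]; exact: (hP n).1.
exists g; split => //; apply/eqP; rewrite eq_le le_lower_integral//=.
rewrite fS -(cvg_lim (@ereal_hausdorff R) ul); apply: lime_le; first by apply/cvg_ex; eexists; exact: ul.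
apply: nearW => n; rewrite -(hP n).2 -integralT_nnsfun.
by apply: le_lower_integral => x //; rewrite lee_fin.
Qed.

Lemma lower_integral_measure_add (m1 m2 : {measure set T -> \bar R}) f :
  (forall x, 0 <= f x) ->
  \int[measure_add m1 m2]_x f x = \int[m1]_x f x + \int[m2]_x f x.
Proof.
move=> f0; apply/eqP; rewrite eq_le; apply/andP; split.
  have [g [mg g0 gf <-]] := @measurable_minorant (measure_add m1 m2) f f0.
  by rewrite ge0_integral_measure_add// leeD// le_lower_integral.
have [g1 [mg1 g10 g1f <-]] := measurable_minorant m1 f0.
have [g2 [mg2 g20 g2f <-]] := measurable_minorant m2 f0.
(* The two measures have different optimal minorants; their maximum is still a minorant and serves
   both. *)
have mg : measurable_fun setT (fun x => maxe (g1 x) (g2 x)) by exact: measurable_maxe.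
apply: (@le_trans _ _ (\int[measure_add m1 m2]_x maxe (g1 x) (g2 x))).
  rewrite ge0_integral_measure_add//; last by move=> x _; rewrite le_max g10.
  by rewrite leeD// le_lower_integral// => x; rewrite le_max lexx ?orbT.
apply: le_lower_integral => x; first by rewrite le_max g10.
by rewrite ge_max g1f g2f.
Qed.

Lemma lower_integral_mscale mu (k : {nonneg R}) f : (forall x, 0 <= f x) ->
  \int[mscale k mu]_x f x = (k%:num)%:E * \int[mu]_x f x.
Proof.
move=> f0; apply/eqP; rewrite eq_le; apply/andP; split.
  have [g [mg g0 gf <-]] := @measurable_minorant (mscale k mu) f f0.
  by rewrite ge0_integral_mscale// lee_wpmul2l// le_lower_integral.
have [g [mg g0 gf <-]] := @measurable_minorant mu f f0.
by rewrite -ge0_integral_mscale// le_lower_integral.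
Qed.

Lemma lower_integralZl mu (k : R) f : (0 < k)%R -> (forall x, 0 <= f x) ->
  \int[mu]_x (k%:E * f x) = k%:E * \int[mu]_x f x.
Proof.
move=> k0; have H (c : R) h : (0 < c)%R -> (forall x, 0 <= h x) ->
    c%:E * \int[mu]_x h x <= \int[mu]_x (c%:E * h x).
  move=> c0 h0; have [g [mg g0 gf <-]] := @measurable_minorant mu h h0.
  rewrite -ge0_integralZl//; last by rewrite lee_fin ltW.
  apply: le_lower_integral => x; first by rewrite mule_ge0// lee_fin ltW.
  by rewrite lee_wpmul2l// lee_fin ltW.
move=> f0; apply/eqP; rewrite eq_le H// andbT.
(* The converse is the same inequality for the inverse factor. *)
rewrite -lee_pdivrMl//; apply: le_trans (H _ _ _ _) _; rewrite ?invr_gt0//.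
  by move=> x; rewrite mule_ge0// lee_fin ltW.
apply: le_lower_integral => x; first by rewrite !mule_ge0// lee_fin// ?invr_ge0 ltW.
by rewrite muleA -EFinM mulVf ?gt_eqF// mul1e.
Qed.

Lemma lower_integral_null mu N f h : measurable N -> mu N = 0 ->
  (forall x, 0 <= f x) -> (forall x, 0 <= h x) ->
  (forall x, ~ N x -> f x = h x) ->
  \int[mu]_x f x = \int[mu]_x h x.
Proof.
move=> mN N0; suff H f' h' : (forall x, 0 <= f' x) -> (forall x, 0 <= h' x) ->
    (forall x, ~ N x -> f' x = h' x) -> \int[mu]_x f' x <= \int[mu]_x h' x.
  move=> f0 h0 fh; apply/eqP; rewrite eq_le !H// => x Nx.
  by rewrite fh.
move=> f0 h0 fh; have [g [mg g0 gf <-]] := @measurable_minorant mu f' f0.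
rewrite (@ge0_negligible_integral _ _ _ mu _ N)// setTD.
rewrite integral_mkcond; apply: le_lower_integral => x; rewrite patchE; case: ifPn => //.
by rewrite inE/= => /fh <-.
Qed.
End lower_integral.

Section lower_pushforward.
Context d1 d2 (X : measurableType d1) (Y : measurableType d2) (R : realType).
Variables (phi : X -> Y) (psi : Y -> X).
Hypotheses (mphi : measurable_fun setT phi) (mpsi : measurable_fun setT psi).
Hypotheses (phiK : cancel phi psi) (psiK : cancel psi phi).
Variables (mu : {measure set X -> \bar R}) (nu : {measure set Y -> \bar R}).
Local Open Scope ereal_scope.
Hypothesis munu : forall A, measurable A -> nu A = mu (phi @^-1` A).

(** Minorants of f pull back along [phi]; minorants of the composite return along [psi], which is
    where a measurable inverse is indispensable. *)
Lemma lower_integral_bij (f : Y -> \bar R) : (forall y, 0 <= f y) ->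
  \int[nu]_y f y = \int[mu]_x f (phi x).
Proof.
move=> f0; apply/eqP; rewrite eq_le; apply/andP; split.
  have [g [mg g0 gf <-]] := @measurable_minorant _ _ _ nu f f0.
  rewrite (eq_measure_integral (pushforward mu phi)); last by move=> A mA _; rewrite munu.
  rewrite ge0_integral_pushforward//= preimage_setT.
  by apply: le_lower_integral => x /=.
have [g [mg g0 gf <-]] := @measurable_minorant _ _ _ mu (f \o phi) (fun x => f0 _).
apply: (@le_trans _ _ (\int[nu]_y g (psi y))).
  rewrite [leRHS](eq_measure_integral (pushforward mu phi)); last by move=> A mA _; rewrite munu.
  rewrite (ge0_integral_pushforward mphi)//=; last exact: (measurableT_comp mg mpsi).
  by rewrite preimage_setT; apply: le_lower_integral => x //=; rewrite phiK.
apply: le_lower_integral => y //=.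
by apply: le_trans (gf _) _ => /=; rewrite psiK.
Qed.

Lemma integral_bij D (f : Y -> \bar R) :
  \int[nu]_(y in D) f y = \int[mu]_(x in phi @^-1` D) f (phi x).
Proof.
rewrite [LHS]integral_mkcond [RHS]integral_mkcond integralE [RHS]integralE.
have -> : (fun x => f (phi x)) \_ (phi @^-1` D) = (f \_ D) \o phi.
  by apply/funext => x; rewrite /= !patchE; congr (if _ then _ else _); apply/idP/idP; rewrite !inE.
rewrite !lower_integral_bij; [|by []..].
by congr (_ - _); apply: eq_integral => x _; rewrite ?funeposE ?funenegE.
Qed.
End lower_pushforward.

(** * Measurability of the counting variables *)

Section configurations.
Context {R : realType}.
Implicit Types (g : Conf R) (A D : set (measurableTypeR R)).

Lemma conf_ext g1 g2 : (forall A, g1 A = g2 A) -> g1 = g2.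
Proof.
case: g1 g2 => [m1 p1] [m2 p2] /= m12.
have m12' : m1 = m2 by apply: eq_measure; apply/funext.
by case: _ / m12' p2 => p2; congr MkConf; exact: Prop_irrelevance.
Qed.

Lemma conf_lty g A : measurable A -> bounded_set (A : set R) -> (g A < +oo)%E.
Proof. by move=> mA bA; have [n ->] := confP g mA bA; rewrite ltry. Qed.

(** The sets that do not separate [g1] from [g2] form a sigma-algebra, and it contains the vaguely
    open sets because [vague_eval] takes the same value at both. *)
Lemma measurable_conf_indist (S : set (Conf R)) g1 g2 : measurable S ->
  (forall A, measurable A -> g1 A = g2 A) -> S g1 -> S g2.
Proof.
move=> mS g12; suff : (S g1 <-> S g2) by case.
have vE : vague_eval g1 = vague_eval g2.
  apply/funext => f; rewrite /vague_eval /Rintegral; congr fine.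
  by apply: eq_measure_integral => A mA _; exact: g12.
apply: (mS [set S | S g1 <-> S g2]); split; [split|].
- by [].
- by move=> A /= AE; split=> -[_ nA]; split => // /AE.
- by move=> F FE /=; split => -[n _ /(FE n) Fn]; exists n.
- by move=> U [V oV <-] /=; rewrite vE.
Qed.

Lemma measurable_fun_conf_indist (F : Conf R -> R) g1 g2 : measurable_fun setT F ->
  (forall A, measurable A -> g1 A = g2 A) -> F g1 = F g2.
Proof.
move=> mF g12.
apply/esym/(@measurable_conf_indist (F @^-1` [set F g1]) g1 g2) => //.
by rewrite -[X in measurable X]setTI; exact: mF.
Qed.

Let measurable_double :
  measurable_fun setT ((fun x => x * 2) : measurableTypeR R -> measurableTypeR R).
Proof. by apply: continuous_measurable_fun => x; apply: cvgM; [exact: cvg_id|exact: cvg_cst]. Qed.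

Lemma bounded_double (A : set R) :
  bounded_set A -> bounded_set ((fun x => x * 2) @^-1` A : set R).
Proof.
move=> /bounded_setE[M AM]; apply/bounded_setE; exists (M / 2) => x /AM.
by rewrite normrM (ger0_norm (_ : 0 <= 2))// ler_pdivlMr.
Qed.

Definition dil2 : Conf R -> Conf R := mapconf measurable_double bounded_double.

Lemma dil2E g A : dil2 g A = g ((fun x => x * 2) @^-1` A).
Proof. by []. Qed.

Lemma comp2E g A : comp2 g A = g ((fun x => x / 2) @^-1` A).
Proof. by []. Qed.

Lemma comp2K : cancel (@comp2 R) dil2.
Proof.
move=> g; apply: conf_ext => A; rewrite dil2E comp2E; congr (g _).
by apply/seteqP; split => x /=; rewrite divfK.
Qed.

Lemma dil2K : cancel dil2 (@comp2 R).
Proof.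
move=> g; apply: conf_ext => A; rewrite comp2E dil2E; congr (g _).
by apply/seteqP; split => x /=; rewrite mulfK.
Qed.

Let double_cont (f : Cc R) : continuous ((fun x => f (x * 2)) : R -> R).
Proof.
move=> x; apply: (@cvg_comp _ _ _ (fun x : R => x * 2) f _ (nbhs (x * 2))); last exact: Cc_cont.
by apply: cvgM; [exact: cvg_id|exact: cvg_cst].
Qed.

Lemma compact_closure_neq0 (f : R -> R) (M : R) :
  (forall x, M < `|x| -> f x = 0) -> compact (closure [set x : R | f x != 0]).
Proof.
move=> fM; apply: (subclosed_compact _ (@segment_compact _ (- M) M)).
  exact: closed_closure.
have cl : closed `[- M, M] by exact: interval_closed.
rewrite [X in _ `<=` X]((closure_id _).1 cl); apply: closure_subset => x /= fx.
rewrite in_itv/= -ler_norml leNgt; apply/negP => Mx.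
by move: fx; rewrite fM ?eqxx.
Qed.

Let double_supp (f : Cc R) : compact (closure [set x : R | f (x * 2) != 0]).
Proof.
have [M fM] := Cc_supportE f.
apply: (@compact_closure_neq0 _ (M / 2)) => x Mx; apply: fM.
by rewrite normrM (ger0_norm (_ : 0 <= 2))// -ltr_pdivrMr.
Qed.

Lemma measurable_dil2 : measurable_fun setT dil2.
Proof.
have cdil : continuous dil2.
  apply: continuous_into_conf => f.
  pose f2 := MkCc (@double_cont f) (@double_supp f).
  have -> : (fun g : Conf R => (\int[dil2 g]_y f y)%R) = (fun g => (\int[g]_y f2 y)%R).
    apply/funext => g.
    rewrite /Rintegral/= (@integral_pushforward _ _ _ _ _ _ measurable_double)//.
    - by apply/measurable_EFinP; exact: Cc_measurable.
    - by rewrite preimage_setT; exact: (Cc_integrable f2 g).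
  exact: continuous_Rint.
apply: (@measurability _ _ _ _ _ _ (@open (Conf R))) => // _ [U oU <-].
rewrite setTI; apply: sub_sigma_algebra.
by move/continuousP : cdil; exact.
Qed.

Lemma shiftconf_comp2 (t : R) g :
  shiftconf t (comp2 g) = comp2 (shiftconf (t * 2) g).
Proof.
apply: conf_ext => A.
suff AE : (fun x : R => x / 2) @^-1` ((fun x => x - t) @^-1` A) =
  (fun x : R => x - t * 2) @^-1` ((fun x => x / 2) @^-1` A) by exact: (congr1 g AE).
by apply/seteqP; split => x /=; rewrite mulrBl mulfK.
Qed.

(* Decreases in n to the indicator function of [a, b], also when b < a. *)
Definition trapezoid (a b : R) (n : nat) (x : R) : R :=
  Num.max 0 (1 - n.+1%:R * Num.max 0 (Num.max (a - x) (x - b))).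

Let trapezoid_cont a b n : continuous (trapezoid a b n : R -> R).
Proof.
move=> x; rewrite /trapezoid.
apply: (@continuous_max _ _ (cst 0)
  (fun x => 1 - n.+1%:R * Num.max 0 (Num.max (a - x) (x - b))) x); first exact: cvg_cst.
apply: cvgB; first exact: cvg_cst.
apply: cvgM; first exact: cvg_cst.
apply: (@continuous_max _ _ (cst 0) (fun x => Num.max (a - x) (x - b)) x); first exact: cvg_cst.
apply: (@continuous_max _ _ (fun x => a - x) (fun x => x - b) x).
- by apply: cvgB; [exact: cvg_cst|exact: cvg_id].
- by apply: cvgB; [exact: cvg_id|exact: cvg_cst].
Qed.

Let trapezoid_in a b n x : a <= x <= b -> trapezoid a b n x = 1.
Proof.
move=> /andP[ax xb]; rewrite /trapezoid [Num.max 0 (Num.max _ _)]max_l.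
  by rewrite mulr0 subr0 max_r.
by rewrite ge_max !subr_le0 ax.
Qed.

Let trapezoid_out a b n x : 1 <= n.+1%:R * Num.max (a - x) (x - b) -> trapezoid a b n x = 0.
Proof.
move=> h; rewrite /trapezoid max_l// subr_le0; apply: le_trans h _.
by rewrite ler_wpM2l// le_max lexx orbT.
Qed.

Let trapezoid_le1 a b n x : 0 <= trapezoid a b n x <= 1.
Proof.
rewrite /trapezoid le_max lexx/= ge_max ler01/= gerBl mulr_ge0//.
by rewrite le_max lexx.
Qed.

Let trapezoid_far a b n x : Num.max `|a| `|b| + 1 < `|x| -> trapezoid a b n x = 0.
Proof.
move=> h; apply: trapezoid_out.
have {}h : 1 <= Num.max (a - x) (x - b).
  rewrite le_max; have := ler_norm (- a); have := ler_norm b; rewrite normrN.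
  have : `|a| <= Num.max `|a| `|b| by rewrite le_max lexx.
  have : `|b| <= Num.max `|a| `|b| by rewrite le_max lexx orbT.
  move: (Num.max _ _) h => m; case: (leP 0 x) => x0.
    by rewrite ger0_norm// => h h1 h2 h3 h4; apply/orP; right; lra.
  by rewrite ltr0_norm// => h h1 h2 h3 h4; apply/orP; left; lra.
by rewrite -[leLHS]mulr1 ler_pM// ler1n.
Qed.

Let trapezoid_supp a b n : compact (closure [set x : R | trapezoid a b n x != 0]).
Proof. by apply: compact_closure_neq0 => x; exact: trapezoid_far. Qed.

Let Cc_trapezoid a b n := MkCc (@trapezoid_cont a b n) (@trapezoid_supp a b n).

Let trapezoid_cvg a b x : trapezoid a b n x @[n --> \oo] --> (\1_(`[a, b]) x : R).
Proof.
rewrite indicE; have [|xab] := boolP (x \in _).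
  rewrite inE/= in_itv/= => xab.
  rewrite (_ : (fun n => _) = cst 1); first exact: cvg_cst.
  by apply/funext => n; rewrite trapezoid_in.
have {}xab : 0 < Num.max (a - x) (x - b).
  move: xab; rewrite notin_setE/= in_itv/= => /negP; rewrite negb_and -!ltNge.
  by rewrite lt_max !subr_gt0.
apply: cvg_near_cst; near=> n; apply: trapezoid_out.
rewrite -ler_pdivrMl// mulr1; apply: ltW.
near: n; exact: (near_infty_natSinv_lt (PosNum xab)).
Unshelve. all: by end_near. Qed.

(** The integrals of the trapezoids are vaguely continuous; they converge to the count by domination
    by the first trapezoid. *)
Lemma measurable_conf_itv (a b : R) :
  measurable_fun setT (fun g : Conf R => g `[a, b]%classic).
Proof.
apply: (@emeasurable_fun_cvg _ _ _ _ (fun n (g : Conf R) => (\int[g]_x trapezoid a b n x)%R%:E)).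
  move=> n; apply/measurable_EFinP.
  apply: (measurability _ (RGenOInfty.measurableE R)).
  move=> _ [_ [x ->] <-]; rewrite setTI; apply: sub_sigma_algebra.
  have /continuousP := @continuous_Rint _ (Cc_trapezoid a b n); apply.
  exact: interval_open.
move=> g _.
have mab : measurable (`[a, b]%classic : set (measurableTypeR R)) by exact: measurable_itv.
have -> : g `[a, b]%classic = (\int[g]_x (\1_(`[a, b]) x)%:E)%E.
  by rewrite integral_indic// setIT.
rewrite (_ : (fun n => _) = (fun n => \int[g]_x (trapezoid a b n x)%:E)%E); last first.
  apply/funext => n; rewrite /Rintegral fineK//.
  by apply: integrable_fin_num => //; exact: (Cc_integrable (Cc_trapezoid a b n)).
apply: (@dominated_cvg _ _ _ g setT _ _ _ (EFin \o trapezoid a b 0)) => //.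
- move=> n; apply/measurable_EFinP; exact: (Cc_measurable (Cc_trapezoid a b n)).
- by move=> x _; apply/fine_cvgP; split; [exact: nearW|exact: trapezoid_cvg].
- exact: (Cc_integrable (Cc_trapezoid a b 0)).
- move=> n x _ /=; rewrite lee_fin ger0_norm; last by case/andP: (trapezoid_le1 a b n x).
  rewrite /trapezoid ge_max !le_max lexx/=; apply/orP; right.
  by rewrite lerD2l lerN2 ler_wpM2r ?ler_nat// le_max lexx.
Qed.

Lemma measurable_conf_ev A : measurable A ->
  measurable_fun setT (fun g : Conf R => g A).
Proof.
pose D k : set (measurableTypeR R) := `[- k%:R, k%:R]%classic.
have mD k : measurable (D k) by exact: measurable_itv.
have bD k : bounded_set (D k : set R).
  by apply/bounded_setE; exists k%:R => x; rewrite /D/= in_itv/= -ler_norml.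
(* Traces on a bounded window have finite mass, so that the complement step of the Dynkin argument
   is a genuine subtraction. *)
move=> mA; have mAD k : measurable_fun setT (fun g : Conf R => g (A `&` D k)).
  have : <<s (@RGenCInfty.G R) >> A.
    have := RGenCInfty.measurableE R; rewrite /measurable/= => <-.
    exact: mA.
  move: A {mA}; apply: (@dynkin_induction _ (measurableTypeR R)) => //.
  - exact: RGenCInfty.measurableE.
  - move=> _ _ [x ->] [y ->]; exists (Num.max x y).
    by apply/seteqP; split=> z /=; rewrite !in_itv/= !andbT ge_max; [move=> [-> ->]|move=> /andP[]].
  - by rewrite setTI; exact: measurable_conf_itv.
  - move=> _ [x ->]; rewrite (_ : _ `&` _ = `[Num.max x (- k%:R), k%:R]%classic); last first.
      apply/seteqP; split=> y; rewrite /D/= !in_itv/= andbT ge_max.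
        by move=> [-> /andP[-> ->]].
      by move=> /andP[/andP[-> ->] ->].
    exact: measurable_conf_itv.
  - move=> S mS mSD; rewrite (_ : (fun g => _) = (fun g : Conf R => g (D k) - g (S `&` D k)))%E; last first.
      apply/funext => g; rewrite setIC -setDE setIC measureD//.
      exact: conf_lty.
    by apply: emeasurable_funB => //; exact: measurable_conf_itv.
  - move=> F mF tF mFD.
    rewrite (_ : (fun g => _) = (fun g : Conf R => \sum_(n <oo) g (F n `&` D k)))%E; last first.
      apply/funext => g; rewrite setI_bigcupl measure_bigcup//.
      - by apply: eq_eseriesl => n; rewrite in_setT.
      - by move=> n _; exact: measurableI.
      - exact: trivIset_setIr.
    by apply: ge0_emeasurable_sum => // n.
apply: (@emeasurable_fun_cvg _ _ _ _ (fun k (g : Conf R) => g (A `&` D k))) => // g _.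
have {2}-> : A = \bigcup_k (A `&` D k).
  rewrite -setI_bigcupr; apply/esym/setIidPl => x _.
  exists (Num.truncn `|x|).+1 => //; rewrite /D/= in_itv/= -ler_norml.
  exact/ltW/truncnS_gt.
apply: nondecreasing_cvg_mu => //.
- by move=> k; exact: measurableI.
- by apply: bigcup_measurable => k _; exact: measurableI.
- move=> m n mn; apply/subsetPset; apply: setIS => x; rewrite /D/= !in_itv/= -!ler_norml.
  by move=> /le_trans; apply; rewrite ler_nat.
Qed.

(** The class of [emptyconf] up to values on non-Borel sets. A Borel set contains all of it or none
    of it, so it takes the place of the singleton. *)
Definition null_conf : set (Conf R) := [set g | g setT = 0%E].

Lemma measurable_null_conf : measurable null_conf.
Proof.
rewrite -[X in measurable X]setTI.
exact: (measurable_conf_ev measurableT measurableT (emeasurable_set1 0%E)).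
Qed.

Lemma null_confE g A : measurable A -> null_conf g -> g A = 0%E.
Proof.
move=> mA g0; apply/eqP; rewrite eq_le measure_ge0 andbT -[leRHS]g0.
by rewrite le_measure// ?inE.
Qed.

End configurations.

(** * Configurations on bounded sets are finite sums of Dirac masses *)

Section atoms.
Context {R : realType}.
Implicit Types (g : Conf R) (A D : set (measurableTypeR R)) (s : seq R).

Lemma conf_of_seqE s A : conf_of_seq s A = (count (mem A) s)%:R%:E.
Proof.
elim: s => [|x s IH] /=; first by [].
rewrite -[LHS]/(measure_add (diracconf x) (conf_of_seq s) A).
by rewrite measure_addE IH /= diracE natrD EFinD.
Qed.

Lemma conf_lt1 g A : measurable A -> bounded_set (A : set R) -> (g A < 1)%E -> g A = 0%E.
Proof.
move=> mA bA; have [n ->] := confP g mA bA.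
by rewrite lte_fin ltrn1 ltnS leqn0 => /eqP ->.
Qed.

(** If no point had mass, the integer masses of shrinking intervals around a point would tend to 0,
    hence vanish eventually; countably many null intervals with rational endpoints would then cover
    D. *)
Lemma conf_atom g D : measurable D -> bounded_set (D : set R) -> g D != 0%E ->
  exists2 x, D x & g [set x] != 0%E.
Proof.
move=> mD bD gD0; apply: contrapT => noatom.
have g1 x : D x -> g [set x] = 0%E.
  by move=> Dx; apply/eqP/negPn/negP => gx; apply: noatom; exists x.
pose J (k : rat * rat) : set (measurableTypeR R) := D `&` `]ratr k.1, ratr k.2[%classic.
have mJ k : measurable (J k) by apply: measurableI.
pose N (n : nat) : set (measurableTypeR R) :=
  if @pickle_inv (rat * rat)%type n is Some k then
    if g (J k) == 0%E then J k else set0 else set0.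
have N0 n : g.-negligible (N n).
  rewrite /N; case: pickle_inv => [k|]; last exact: negligible_set0.
  case: ifPn => [/eqP gk|_]; last exact: negligible_set0.
  exact/negligibleP.
move/negP: gD0; apply; apply/eqP/negligibleP => //.
apply: negligibleS (negligible_bigcup N0) => x Dx.
pose F n : set (measurableTypeR R) := D `&` `]x - n.+1%:R^-1, x + n.+1%:R^-1[%classic.
have mF n : measurable (F n) by apply: measurableI.
have bF n : bounded_set (F n : set R) by apply: sub_boundedr bD => P DP y [] /DP.
have FE : \bigcap_n F n = [set x].
  apply/seteqP; split => [y Fy|_ -> n _]; last first.
    by split=> //=; rewrite in_itv/= ltrBlDr !ltrDl invr_gt0 ltr0n.
  apply/eqP/negPn/negP => yx.
  have xy0 : 0 < `|y - x| by rewrite normr_gt0 subr_eq0.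
  have [m _ /(_ m (leqnn m))/= mxy] := near_infty_natSinv_lt (PosNum xy0).
  have [_] := Fy m I; rewrite /= in_itv/= => /andP[h1 h2].
  suff : `|y - x| < m.+1%:R^-1 by rewrite ltNge (ltW mxy).
  by rewrite ltr_norml ltrBlDl h2 ltrBrDl h1.
have : (g \o F) n @[n --> \oo] --> g (\bigcap_n F n).
  apply: nonincreasing_cvg_mu => //.
  - exact: conf_lty.
  - by rewrite FE.
  - move=> m n mn; apply/subsetPset; apply: setIS => y; rewrite /= !in_itv/= => /andP[h1 h2].
    have mn' : n.+1%:R^-1 <= m.+1%:R^-1 :> R by rewrite lef_pV2 ?posrE ?ltr0n// ler_nat.
    by apply/andP; split;
      [apply: le_lt_trans h1; rewrite lerD2l lerN2|apply: lt_le_trans h2 _; rewrite lerD2l].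
rewrite FE g1// => /(_ [set y | y < 1]%E)[].
  by apply: open_nbhs_nbhs; split => //=; exact: open_ereal_lt_ereal.
move=> n _ /(_ n (leqnn n))/= gFn.
have {}gFn : g (F n) = 0%E by exact: conf_lt1.
have [p] := @rat_in_itvoo R (x - n.+1%:R^-1) x ltac:(by rewrite ltrBlDr ltrDl invr_gt0 ltr0n).
have [q] := @rat_in_itvoo R x (x + n.+1%:R^-1) ltac:(by rewrite ltrDl invr_gt0 ltr0n).
rewrite !in_itv/= => /andP[q1 q2] /andP[p1 p2].
have [k kE] : exists k, pickle_inv k = Some (p, q).
  by eexists; exact: pickleK_inv.
exists k => //; rewrite /N kE.
have -> : g (J (p, q)) = 0%E.
  apply/eqP; rewrite eq_le measure_ge0 andbT -[leRHS]gFn le_measure ?inE//.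
  apply: setIS => y /=; rewrite !in_itv/= => /andP[y1 y2].
  by rewrite (lt_trans p1 y1) (lt_trans y2 q2).
by rewrite eqxx; split => //=; rewrite in_itv/= p2 q1.
Qed.

(** Strong induction on the number of points: an atom, removed with its full multiplicity, lowers
    the count. *)
Lemma conf_atoms g D : measurable D -> bounded_set (D : set R) ->
  exists2 s : seq R, (forall x, x \in s -> D x) &
    forall A, measurable A -> A `<=` D -> g A = conf_of_seq s A.
Proof.
move=> mD bD; have [n] := confP g mD bD.
elim/ltn_ind: n D mD bD => n IH D mD bD gD.
have [gD0|/conf_atom] := eqVneq (g D) 0%E.
  exists [::] => // A mA AD; apply/eqP; rewrite eq_le measure_ge0 andbT.
  by rewrite -[leRHS]gD0 le_measure ?inE.
move=> /(_ mD bD)[x Dx gx0].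
have mx : measurable ([set x] : set (measurableTypeR R)) by [].
have mDx : measurable (D `\` [set x]) by apply: measurableD.
have bDx : bounded_set (D `\` [set x] : set R) by apply: sub_boundedr bD => P DP y [] /DP.
have bx : bounded_set ([set x] : set R) by apply: sub_boundedr bD => P DP y -> /=; exact: DP.
have [m gx] := confP g mx bx.
have [k gk] := confP g mDx bDx.
have splitx A : measurable A -> g A = (g (A `\` [set x]) + g (A `&` [set x]))%E.
  by move=> mA; rewrite -measureDI.
have nmk : n = (k + m)%N.
  move: (splitx D mD); rewrite gD gk (setIidr (_ : [set x] `<=` D)) ?gx; last by move=> _ ->.
  by rewrite -EFinD -natrD => -[] /eqP; rewrite eqr_nat => /eqP.
have m0 : (0 < m)%N by rewrite lt0n; move: gx0; rewrite gx; apply: contra => /eqP ->.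
have [|s sD gs] := IH k _ _ mDx bDx gk; first by rewrite nmk -addn1 leq_add2l.
exists (nseq m x ++ s) => [y|A mA AD].
  by rewrite mem_cat mem_nseq => /orP[/andP[_ /eqP ->]//|/sD[]].
rewrite splitx// gs//; [|exact: measurableD|exact: setSD].
rewrite !conf_of_seqE count_cat count_nseq natrD EFinD addeC; congr (_ + _)%E.
  congr (_%:R%:E); apply: eq_in_count => y /sD[Dy yx].
  by apply/idP/idP; rewrite !inE; [case|].
have [Ax|nAx] := pselect (A x).
  rewrite (_ : A `&` _ = [set x]); last by apply/setIidr => _ ->.
  by rewrite gx /= mem_set// mul1n.
rewrite (_ : A `&` _ = set0); last by apply/seteqP; split => // y [Ay yx]; rewrite yx in Ay.
by rewrite measure0 /= memNset// mul0n.
Qed.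

Lemma lower_integral_dirac d (T : measurableType d) (a : T) (f : T -> \bar R) :
  measurable [set a] -> (forall x, 0 <= f x)%E -> (\int[\d_a]_x f x = f a)%E.
Proof.
move=> ma f0; rewrite (@lower_integral_null _ _ _ _ (~` [set a]) _ (cst (f a)))//.
- by rewrite integral_dirac// diracT mul1e.
- exact: measurableC.
- by rewrite /= diracE memNset//; apply.
- by move=> x; exact: f0.
- by move=> x /= /contrapT ->.
Qed.

Lemma lower_integral_conf_of_seq s (f : R -> \bar R) : (forall x, 0 <= f x)%E ->
  (\int[conf_of_seq s]_x f x = \sum_(x <- s) f x)%E.
Proof.
move=> f0; elim: s => [|x s IH]; first by rewrite big_nil integral_measure_zero.
rewrite big_cons -IH [LHS](lower_integral_measure_add (diracconf x) (conf_of_seq s))//.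
by rewrite [X in (X + _)%E]lower_integral_dirac.
Qed.

(** Singletons of the line are Borel, so Dirac masses evaluate an arbitrary f. The nested integrals
    in [Mov] and [Hen] become finite sums without any study of the inner integral. *)
Lemma Rint_atoms g D s (f : R -> R) : (forall x, x \in s -> D x) ->
  (forall A, measurable A -> A `<=` D -> g A = conf_of_seq s A) ->
  (\int[g]_(x in D) f x = \sum_(x <- s) f x)%R.
Proof.
move=> sD gs; rewrite /Rintegral (eq_measure_integral (conf_of_seq s)); last exact: gs.
rewrite integral_mkcond integralE !lower_integral_conf_of_seq//.
rewrite (eq_big_seq (fun x => (f^\+ x)%R%:E)); last first.
  by move=> x /sD Dx; rewrite -[RHS]/((EFin \o f^\+%R) x) -funerpos !funeposE patchE mem_set.
rewrite [X in (_ - X)%E](eq_big_seq (fun x => (f^\- x)%R%:E)); last first.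
  by move=> x /sD Dx; rewrite -[RHS]/((EFin \o f^\-%R) x) -funerneg !funenegE patchE mem_set.
rewrite !sumEFin /= -sumrB; apply: eq_bigr => x _.
by rewrite -[in RHS](funrposBneg f).
Qed.
Lemma simple_atoms_uniq g D (s : seq R) : (forall x, x \in s -> D x) ->
  (forall A, measurable A -> A `<=` D -> g A = conf_of_seq s A) ->
  simple_conf g -> uniq s.
Proof.
move=> sD gs simp.
apply/count_mem_uniq => x; have [xs|xs] := boolP (x \in s); last exact/count_memPn.
apply/eqP; rewrite eqn_leq -has_count has_pred1 xs andbT.
have := simp x; rewrite gs//; last by move=> _ ->; exact: sD.
rewrite conf_of_seqE lee_fin -[leRHS]/(1%:R) ler_nat; apply: leq_trans.
by apply: sub_count => y /= /eqP ->; rewrite inE.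
Qed.

End atoms.

(** * The binomial process under compression *)

Section compression_of_binomial.
Context {R : realType}.
Local Notation leb := (@lebesgue_measure R).
Local Notation half := ((fun x => x / 2) : measurableTypeR R -> measurableTypeR R).

(** By uniqueness of Lebesgue measure: half of its image under halving has the right value on
    half-open intervals. *)
Lemma lebesgue_measure_half (X : set (measurableTypeR R)) : measurable X ->
  leb (half @^-1` X) = (2%:E * leb X)%E.
Proof.
move=> mX.
have mh := @measurable_half R.
have m2 : {m : {measure set (measurableTypeR R) -> \bar R} |
    forall A, m A = ((2^-1)%:E * leb (half @^-1` A))%E}.
  unshelve eexists (mscale (2^-1 : R)%:nng (pushforward leb half : {measure set _ -> \bar R})).
    exact: mh.
  by [].
have [m mE] := m2.
have -> : leb X = m X.
  apply: lebesgue_measure_unique => // _ [[a b] _ <-]; rewrite mE/=.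
  have -> : half @^-1` `]a, b]%classic = `]a * 2, b * 2]%classic.
    by apply/seteqP; split => x /=; rewrite !in_itv/= ltr_pdivlMr// ler_pdivrMr.
  rewrite !lebesgue_measure_itv/= !lte_fin ltr_pM2r//; case: ifPn => _; last by rewrite mule0.
  by rewrite -EFinB -EFinM -mulrBl mulrCA mulVf// mulr1.
by rewrite mE muleA -EFinM mulfV// mul1e.
Qed.

Lemma unifE (Lambda : set (measurableTypeR R)) (mL : measurable Lambda) A :
  unif mL A = if (leb Lambda == 0%E) || (leb Lambda == +oo%E) then \d_(0 : measurableTypeR R) A
              else (leb (A `&` Lambda) * (fine (leb Lambda))^-1%:E)%E.
Proof.
rewrite -[LHS]/(mnormalize (mrestr leb mL) (\d_(0 : measurableTypeR R)) A) /mnormalize.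
rewrite /= /mrestr setTI; by case: ifP.
Qed.

Variables (Lambda : set (measurableTypeR R)) (mL : measurable Lambda).
Variable (mL2 : measurable (half @^-1` Lambda)).

Lemma unif_half A : measurable A -> unif mL A = unif mL2 (half @^-1` A).
Proof.
move=> mA; rewrite !unifE.
have e (B : set (measurableTypeR R)) : measurable B ->
    leb ((half @^-1` B) `&` (half @^-1` Lambda)) = (2%:E * leb (B `&` Lambda))%E.
  by move=> mB; rewrite -preimage_setI lebesgue_measure_half//; exact: measurableI.
have eL := lebesgue_measure_half mL.
have -> : (leb (half @^-1` Lambda) == 0%E) = (leb Lambda == 0%E).
  by rewrite eL mule_eq0 eqe pnatr_eq0.
have -> : (leb (half @^-1` Lambda) == +oo%E) = (leb Lambda == +oo%E).
  rewrite eL; apply/idP/idP => [|/eqP ->]; last by rewrite gt0_muley// lte_fin.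
  have : (0 <= leb Lambda)%E by exact: measure_ge0.
  by case: (leb Lambda).
(* In the degenerate case the default law is the Dirac mass at 0, a fixed point of halving. *)
case: ifPn => [_|].
  by rewrite !diracE; congr (_%:R%:E); congr nat_of_bool; apply/idP/idP; rewrite !inE/= mul0r.
rewrite negb_or => /andP[L0 Ly].
rewrite e// eL.
have Lfin : leb Lambda \is a fin_num by rewrite ge0_fin_numE ?measure_ge0// ltey.
rewrite fineM//= invfM EFinM muleACA -EFinM mulfV// mul1e//.
Qed.

Lemma iid_map d1 d2 (T1 : measurableType d1) (T2 : measurableType d2)
    (phi : T1 -> T2) (P1 : probability T1 R) (P2 : probability T2 R) :
  measurable_fun setT phi ->
  (forall A, measurable A -> P2 A = P1 (phi @^-1` A)) ->
  forall n (A : set (n.-tuple T2)), measurable A ->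
    iid P2 n A = iid P1 n ((fun t : n.-tuple T1 => map_tuple phi t) @^-1` A).
Proof.
move=> mphi P12; elim=> [|n IH] A mA.
  rewrite /= !diracE; congr (_%:R%:E); congr nat_of_bool.
  have e : map_tuple phi [tuple] = [tuple] :> 0.-tuple T2 by exact: val_inj.
  by apply/idP/idP; rewrite !inE /preimage/= e.
have mmap : measurable_fun setT (fun t : n.-tuple T1 => map_tuple phi t : n.-tuple T2).
  apply/measurable_fun_tnthP => i.
  rewrite (_ : _ \o _ = phi \o (fun t : n.-tuple T1 => tnth t i)).
    by apply: measurableT_comp => //; exact: measurable_tnth.
  by apply/funext => t /=; rewrite tnth_map.
rewrite /= /distribution /pushforward.
set C2 := @consT _ T2 n @^-1` A.
have mC2 : measurable C2.
  by rewrite -[X in measurable X]setTI; apply: measurable_consT.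
rewrite /product_measure1.
rewrite (eq_measure_integral (pushforward P1 phi)); last by move=> B mB _; exact: P12.
rewrite (ge0_integral_pushforward mphi)//=.
  rewrite preimage_setT; apply: eq_integral => x _ /=.
  rewrite IH; last exact: measurable_xsection.
  have consE t : consT (phi x, map_tuple phi t) = map_tuple phi (consT (x, t)) by exact: val_inj.
  congr (iid P1 n _); apply/seteqP; split => t /=; rewrite /xsection/= !inE /C2/=.
    by rewrite consE.
  by rewrite consE.
exact: measurable_fun_xsection.
Qed.

Lemma conf_of_seq_half (s : seq R) :
  conf_of_seq (map half s) = comp2 (conf_of_seq s).
Proof.
by apply: conf_ext => A; rewrite comp2E !conf_of_seqE count_map; congr (_%:R%:E).
Qed.

Lemma Bin_half n B : measurable B -> Bin n mL B = Bin n mL2 (@comp2 R @^-1` B).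
Proof.
move=> mB.
have mB' : measurable (@conf_of_tuple R n @^-1` B).
  by rewrite -[X in measurable X]setTI; exact: measurable_conf_of_tuple.
apply: etrans (iid_map (@measurable_half R) unif_half mB') _.
suff -> : (fun t : n.-tuple (measurableTypeR R) => map_tuple half t) @^-1` (@conf_of_tuple R n @^-1` B) =
  @conf_of_tuple R n @^-1` (@comp2 R @^-1` B) by [].
by apply/seteqP; split => t /=; rewrite /conf_of_tuple/= conf_of_seq_half.
Qed.

End compression_of_binomial.

(** * Scaling of the Gibbs kernels *)

Section compression_of_gibbs.
Context {R : realType}.
Local Notation half := ((fun x => x / 2) : measurableTypeR R -> measurableTypeR R).
Implicit Types (eta gamma : Conf R).

(** The convention [logpot 0 = 0] is not shifted by [ln 2]; hence energies change according to the
    number of pairs of distinct points. *)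
Lemma logpot_half (x y : R) : x != y ->
  logpot (x / 2 - y / 2) = logpot (x - y) + ln 2.
Proof.
move=> xy; have xy0 : x - y != 0 by rewrite subr_eq0.
rewrite -mulrBl /logpot mulf_eq0 invr_eq0 pnatr_eq0 orbF (negbTE xy0).
rewrite normrM (ger0_norm (_ : 0 <= 2^-1))// lnM ?posrE ?normr_gt0// lnV ?posrE//.
by rewrite opprD opprK.
Qed.

Lemma sum_seq_cst (s : seq R) (c : R) : \sum_(x <- s) c = (size s)%:R * c.
Proof. by rewrite big_const_seq count_predT iter_addr_0 mulr_natl. Qed.

Lemma Rint_comp2 gamma (D : set (measurableTypeR R)) (f : R -> R) :
  (\int[comp2 gamma]_(x in D) f x = \int[gamma]_(x in half @^-1` D) f (x / 2))%R.
Proof.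
rewrite /Rintegral; congr fine.
apply: (@integral_bij _ _ (measurableTypeR R) (measurableTypeR R) R half (fun x => x * 2)).
- exact: measurable_half.
- by apply: continuous_measurable_fun => x; apply: cvgM; [exact: cvg_id|exact: cvg_cst].
- by move=> x; rewrite divfK.
- by move=> x; rewrite mulfK.
- by [].
Qed.

Lemma npts_conf gamma (D : set (measurableTypeR R)) : measurable D ->
  bounded_set (D : set R) -> gamma D = (npts gamma D)%:R%:E.
Proof.
move=> mD bD; have [n gn] := confP gamma mD bD.
by rewrite /npts gn /= natrK.
Qed.

Lemma atoms_size gamma (D : set (measurableTypeR R)) (s : seq R) n :
  measurable D -> (forall x, x \in s -> D x) ->
  (forall A, measurable A -> A `<=` D -> gamma A = conf_of_seq s A) ->
  gamma D = n%:R%:E -> size s = n.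
Proof.
move=> mD sD gs gD.
have : conf_of_seq s D = n%:R%:E by rewrite -gD gs.
rewrite conf_of_seqE => -[] /eqP; rewrite eqr_nat => /eqP <-.
by apply/esym/eqP; rewrite -all_count; apply/allP => x /sD Dx; rewrite inE.
Qed.

Section scaling.
Variables (Lambda : set (measurableTypeR R)) (mL : measurable Lambda).
Hypothesis bL : bounded_set (Lambda : set R).
Let Lambda2 := half @^-1` Lambda.
Hypothesis mL2 : measurable Lambda2.

Let bL2 : bounded_set (Lambda2 : set R).
Proof. exact: bounded_half. Qed.

Let box_half p : half @^-1` (box p `\` Lambda) = box (p * 2) `\` Lambda2.
Proof.
have boxE x : box p (x / 2) = box (p * 2) x.
  rewrite /box /= !in_itv/= -!ler_norml natrM mulfK// normrM.
  by rewrite (ger0_norm (_ : 0 <= 2^-1))// ler_pM2r// invr_gt0.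
by apply/seteqP; split => x [h1 h2]; split => //; move: h1; rewrite /= boxE.
Qed.

Let bbox p : bounded_set (@box R p : set R).
Proof.
by apply/bounded_setE; exists (p%:R / 2) => x; rewrite /box/= in_itv/= -ler_norml.
Qed.

(* The logarithmic pairing changes by ln 2 times the product of the masses, and
   eta and gamma have the same mass in Lambda2. *)
Lemma Mov_comp2 n p eta gamma : eta Lambda2 = n%:R%:E -> gamma Lambda2 = n%:R%:E ->
  Mov mL p (comp2 eta) (comp2 gamma) = Mov mL2 (p * 2) eta gamma.
Proof.
move=> etaL gammaL.
have restE : restconf mL (comp2 gamma) = comp2 (restconf mL2 gamma).
  by apply: conf_ext.
have mB : measurable (box (p * 2) `\` Lambda2).
  by apply: measurableD => //; exact: measurable_itv.
have bB : bounded_set (box (p * 2) `\` Lambda2 : set R).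
  by apply: sub_boundedr (bbox (p * 2)) => P HP y [] /HP.
have [s sB sE] := conf_atoms gamma mB bB.
have innerE (x : R) : Lambda2 x ->
    (\int[comp2 gamma]_(y in box p `\` Lambda) logpot (x / 2 - y) =
     \int[gamma]_(y in box (p * 2) `\` Lambda2) logpot (x - y) + (size s)%:R * ln 2)%R.
  move=> Lx; rewrite Rint_comp2 box_half !(Rint_atoms _ sB sE).
  rewrite (eq_big_seq (fun y => logpot (x - y) + ln 2)) => [|y /sB[_ Ly]].
    by rewrite big_split/= sum_seq_cst.
  by rewrite logpot_half//; apply/eqP => xy; apply: Ly; rewrite -xy.
have outer (nu : Conf R) : nu Lambda2 = n%:R%:E ->
  (\int[comp2 nu]_(x in Lambda) \int[comp2 gamma]_(y in box p `\` Lambda) logpot (x - y) =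
   \int[nu]_(x in Lambda2) (\int[gamma]_(y in box (p * 2) `\` Lambda2) logpot (x - y)) +
   n%:R * ((size s)%:R * ln 2))%R.
  move=> nuL; have [e eL eE] := conf_atoms nu mL2 bL2.
  rewrite Rint_comp2 !(Rint_atoms _ eL eE).
  rewrite (eq_big_seq _ (fun x xe => innerE x (eL x xe))) big_split/= sum_seq_cst.
  by rewrite (atoms_size mL2 eL eE nuL).
rewrite /Mov restE !outer//; last first.
  by rewrite /= /mrestr setIid.
by rewrite opprD addrACA subrr addr0.
Qed.

(** [ln 2] for each of the n (n - 1) / 2 pairs; at n = 0 the truncated predecessor is multiplied by
    0. *)
Definition hen_shift n : R := 2^-1 * (n%:R * (n.-1%:R * ln 2)).

(** Each point of a simple configuration has n - 1 partners. Otherwise both sides are infinite. *)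
Lemma Hen_comp2 n eta : eta Lambda2 = n%:R%:E ->
  Hen Lambda (comp2 eta) = (Hen Lambda2 eta + (hen_shift n)%:E)%E.
Proof.
move=> etaL; rewrite /Hen.
have simpE : simple_conf (comp2 eta) <-> simple_conf eta.
  split=> h x; have := h (x / 2); have := h (x * 2) ; rewrite !comp2E.
    suff -> : half @^-1` [set x / 2] = [set x] by [].
    by apply/seteqP; split => y /= => [/(mulIf _) -> //|-> //]; rewrite invr_eq0.
  suff -> : half @^-1` [set x] = [set x * 2] by [].
  by apply/seteqP; split => y /= => [<-|->]; rewrite ?divfK ?mulfK.
rewrite (asbool_equiv_eq simpE); case: asboolP => // simp.
have [e eL eE] := conf_atoms eta mL2 bL2.
have se := atoms_size mL2 eL eE etaL.
have ue : uniq e by exact: simple_atoms_uniq eL eE simp.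
rewrite -EFinD; congr (_%:E).
rewrite Rint_comp2 !(Rint_atoms _ eL eE) /hen_shift -mulrDr; congr (_ * _).
have innerE x : x \in e ->
    (\int[comp2 eta]_(y in Lambda `\ x / 2) logpot (x / 2 - y) =
     \int[eta]_(y in Lambda2 `\ x) logpot (x - y) + n.-1%:R * ln 2)%R.
  move=> xe; rewrite Rint_comp2.
  have -> : half @^-1` (Lambda `\ x / 2) = Lambda2 `\ x.
    by apply/seteqP; split => y [h1 h2]; split => //;
      [move=> yx; apply: h2; rewrite /= yx
      |move=> /(mulIf _) yx; apply: h2; apply: yx; rewrite invr_eq0].
  (* The atoms in the section without x; since e has no repetition, exactly one entry is lost. *)
  pose e' := [seq y <- e | y != x].
  have e'size : size e' = n.-1 by rewrite -se -(size_rem xe) (rem_filter x ue).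
  have e'L y : y \in e' -> (Lambda2 `\ x) y.
    by rewrite mem_filter => /andP[yx /eL Ly]; split => //; exact/eqP.
  have e'E A : measurable A -> A `<=` Lambda2 `\ x -> eta A = conf_of_seq e' A.
    move=> mA AL; rewrite eE//; last by move=> y /AL[].
    rewrite !conf_of_seqE count_filter; congr (_%:R%:E); apply: eq_count => y /=.
    by apply/idP/andP => [|[]//]; rewrite inE => Ay; split=> //; apply/eqP; exact: (AL _ Ay).2.
  rewrite !(Rint_atoms _ e'L e'E).
  rewrite (eq_big_seq (fun y => logpot (x - y) + ln 2)) => [|y /e'L[_ /eqP yx]].
    by rewrite big_split/= sum_seq_cst e'size.
  by rewrite logpot_half// eq_sym.
rewrite (eq_big_seq _ innerE) big_split/= sum_seq_cst se.
by [].
Qed.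

End scaling.
End compression_of_gibbs.

Section gibbs_kernels.
Context {R : realType}.
Local Notation half := ((fun x => x / 2) : measurableTypeR R -> measurableTypeR R).
Implicit Types (eta gamma : Conf R) (M : Conf R -> R).
Lemma boltzmann_ge0 Lambda beta M eta : (0 <= boltzmann Lambda beta M eta)%E.
Proof. exact: expeR_ge0. Qed.

Variables (Lambda : set (measurableTypeR R)) (mL : measurable Lambda).

(** [is_Mov_lim] determines M on [conf_n] only; together with [is_Mov_lim_unique] this makes the
    Gibbs kernel independent of the chosen limit. *)
Lemma eq_gibbs beta M M' n B : (forall eta, conf_n n Lambda eta -> M eta = M' eta) ->
  gibbs mL beta M n B = gibbs mL beta M' n B.
Proof.
move=> MM'; have E C : (\int[Bin n mL]_(eta in conf_n n Lambda `&` C) boltzmann Lambda beta M eta =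
    \int[Bin n mL]_(eta in conf_n n Lambda `&` C) boltzmann Lambda beta M' eta)%E.
  by apply: eq_integral => eta; rewrite inE => -[/MM' e _]; rewrite /boltzmann e.
rewrite /gibbs /partition_fun E; congr ((fine _)^-1%:E * _)%E.
by have := E setT; rewrite setIT.
Qed.

Lemma is_Mov_limP gamma M eta : is_Mov_lim mL gamma M ->
  conf_n (npts gamma Lambda) Lambda eta -> Mov mL p eta gamma @[p --> \oo] --> M eta.
Proof.
move=> Mlim etan; apply/subr_cvg0/norm_cvg0P.
have : (`|Mov mL p eta gamma - M eta|%:E @[p --> \oo] --> 0%E).
  apply: (squeeze_cvge _ _ Mlim (f := cst 0%E)); last exact: cvg_cst.
  apply: nearW => p; rewrite lee_fin normr_ge0/=.
  by apply: ereal_sup_ubound; exists eta.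
by move=> /fine_cvgP[].
Qed.

Lemma is_Mov_lim_unique gamma M M' eta : is_Mov_lim mL gamma M ->
  is_Mov_lim mL gamma M' -> conf_n (npts gamma Lambda) Lambda eta -> M eta = M' eta.
Proof.
move=> h h' etan.
exact: (cvg_unique _ (is_Mov_limP h etan) (is_Mov_limP h' etan)).
Qed.

Section scaling.
Hypothesis bL : bounded_set (Lambda : set R).
Let Lambda2 := half @^-1` Lambda.
Hypothesis mL2 : measurable Lambda2.

Let bL2 : bounded_set (Lambda2 : set R).
Proof. exact: bounded_half. Qed.

Lemma is_Mov_lim_comp2 gamma M : is_Mov_lim mL2 gamma M ->
  is_Mov_lim mL (comp2 gamma) (M \o @dil2 R).
Proof.
rewrite /is_Mov_lim => h.
have n2 : (fun p => p * 2)%N @ \oo --> \oo.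
  move=> A [N _ NA]; exists N => // p /= Np; apply: NA => /=.
  by rewrite muln2 -addnn (leq_trans Np)// leq_addr.
(* [comp2] is a bijection between the two sets [conf_n], so the suprema range over the same
   values. *)
rewrite (_ : (fun p => _) = (fun p => ereal_sup [set `|Mov mL2 p eta gamma - M eta|%:E
    | eta in conf_n (npts gamma Lambda2) Lambda2]) \o (fun p => p * 2)%N); last first.
  apply/funext => p /=; congr ereal_sup.
  have gL : gamma Lambda2 = (npts gamma Lambda2)%:R%:E by exact: npts_conf.
  apply/seteqP; split => _ /= [eta etan <-].
    have etan2 : conf_n (npts gamma Lambda2) Lambda2 (dil2 eta).
      by rewrite -[eta]dil2K in etan.
    exists (dil2 eta) => //.
    by rewrite -(Mov_comp2 mL bL mL2 p etan2.2 gL) dil2K.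
  exists (comp2 eta) => //=.
  by rewrite comp2K (Mov_comp2 mL bL mL2 p etan.2 gL).
exact: cvg_comp n2 h.
Qed.

Lemma boltzmann_comp2 beta M n eta : eta Lambda2 = n%:R%:E ->
  boltzmann Lambda beta M (comp2 eta) =
  ((expR (- (beta * hen_shift n)))%:E * boltzmann Lambda2 beta (M \o @comp2 R) eta)%E.
Proof.
move=> etaL; rewrite /boltzmann (Hen_comp2 bL mL2 etaL).
have -> : (expR (- (beta * hen_shift n)))%:E = expeR (- (beta * hen_shift n))%:E by [].
rewrite -expeRD; congr expeR.
have : Hen Lambda2 eta = +oo%E \/ exists r : R, Hen Lambda2 eta = r%:E.
  by rewrite /Hen; case: ifPn => _; [right; eexists|left].
move=> [->|[r ->]].
  rewrite !addye//.
  have [b0|b0|->] := ltgtP beta 0; first by rewrite lt0_muley ?lte_fin.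
    by rewrite gt0_muley ?lte_fin//.
  by rewrite !mul0e mul0r oppr0 oppe0 add0e.
rewrite /=; congr (_%:E).
by rewrite -opprD -mulrDr [r + _]addrC addrA.
Qed.

Lemma integral_boltzmann_comp2 beta M n B :
  (\int[Bin n mL]_(eta in conf_n n Lambda `&` B) boltzmann Lambda beta M eta =
   (expR (- (beta * hen_shift n)))%:E *
   \int[Bin n mL2]_(eta in conf_n n Lambda2 `&` (@comp2 R @^-1` B))
     boltzmann Lambda2 beta (M \o @comp2 R) eta)%E.
Proof.
have e := @integral_bij _ _ _ _ R _ _ (@measurable_comp2 R) measurable_dil2
  (@comp2K R) (@dil2K R) (Bin n mL2) (Bin n mL) (@Bin_half R Lambda mL mL2 n)
  (conf_n n Lambda `&` B) (boltzmann Lambda beta M).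
apply: etrans e _.
rewrite [LHS]integral_mkcond [X in (_ * X)%E]integral_mkcond.
have b0 : forall eta,
    (0 <= (boltzmann Lambda2 beta (M \o @comp2 R) \_ (conf_n n Lambda2 `&` comp2 @^-1` B)) eta)%E.
  by apply: erestrict_ge0 => eta _; exact: boltzmann_ge0.
apply: etrans (lower_integralZl (Bin n mL2) (expR_gt0 (- (beta * hen_shift n))) b0).
apply: eq_integral => eta _; rewrite !patchE.
case: ifPn => [|nB].
  by rewrite inE => -[[h etaL] Bh]; rewrite (boltzmann_comp2 _ _ etaL).
by rewrite mule0.
Qed.

Lemma partition_fun_comp2 beta M n : partition_fun mL beta M n =
  ((expR (- (beta * hen_shift n)))%:E * partition_fun mL2 beta (M \o @comp2 R) n)%E.
Proof.
have := integral_boltzmann_comp2 beta M n setT.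
by rewrite preimage_setT !setIT.
Qed.

Lemma gibbs_comp2 beta M n B : gibbs mL beta M n B =
  gibbs mL2 beta (M \o @comp2 R) n (@comp2 R @^-1` B).
Proof.
rewrite /gibbs integral_boltzmann_comp2 partition_fun_comp2.
set c := expR _; have c0 : 0 < c by exact: expR_gt0.
rewrite muleA; congr (_ * _)%E.
(* The factor c cancels against the partition function. If the latter is infinite, [fine] turns it
   into 0 and both prefactors are 0. *)
have : (0 <= partition_fun mL2 beta (M \o @comp2 R) n)%E.
  by apply: integral_ge0 => eta _; exact: boltzmann_ge0.
case: (partition_fun _ _ _ _) => [r|_|//] /=.
  by move=> _; rewrite invfM -EFinM mulrAC mulVf ?gt_eqF// mul1r.
by rewrite gt0_muley ?lte_fin//= invr0 mul0e.
Qed.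

Lemma admissible_comp2 beta gamma : admissible mL2 beta gamma ->
  admissible mL beta (comp2 gamma).
Proof.
move=> [M [Mlim /andP[Z0 Zy]]]; exists (M \o @dil2 R); split; first exact: is_Mov_lim_comp2.
rewrite partition_fun_comp2.
have -> : ((M \o @dil2 R) \o @comp2 R) = M by apply/funext => g /=; rewrite comp2K.
rewrite -[npts _ _]/(npts gamma Lambda2).
by rewrite mule_gt0 ?lte_fin ?expR_gt0//= lte_mul_pinfty// lee_fin expR_ge0.
Qed.

End scaling.
End gibbs_kernels.

(** * Gibbs kernels of null configurations *)

Section null_configurations.
Context {R : realType}.
Implicit Types (eta gamma : Conf R) (M : Conf R -> R).
Variables (Lambda : set (measurableTypeR R)) (mL : measurable Lambda).

Lemma conf_n0E : conf_n 0 Lambda = @null_conf R.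
Proof.
apply/seteqP; split => [eta [h1 h2]|eta eta0].
  have -> : null_conf eta = (eta (Lambda `|` ~` Lambda) = 0%E) by rewrite setUv.
  apply/eqP; rewrite eq_le measure_ge0 andbT.
  apply: le_trans (measureU2 _ _ _) _ => //; first exact: measurableC.
  rewrite (_ : (0 : \bar R) = eta Lambda + eta (~` Lambda))%E//.
  by rewrite h2; apply/esym; rewrite h1 adde0.
by split; apply: null_confE => //; exact: measurableC.
Qed.

Lemma null_conf_npts gamma : null_conf gamma -> npts gamma Lambda = 0%N.
Proof. by move=> g0; rewrite /npts (null_confE mL g0)/= truncn0. Qed.

Lemma Rint_null (D : set (measurableTypeR R)) gamma (f : R -> R) :
  null_conf gamma -> (\int[gamma]_(x in D) f x = 0)%R.
Proof.
move=> g0; rewrite /Rintegral (eq_measure_integral mzero) ?integral_measure_zero//.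
by move=> A mA _; rewrite (null_confE mA g0).
Qed.

Lemma Mov_null p eta gamma : null_conf eta -> null_conf gamma -> Mov mL p eta gamma = 0.
Proof.
move=> eta0 g0; rewrite /Mov !Rint_null ?subr0//.
by apply: (null_confE _ g0); rewrite setTI.
Qed.

Lemma simple_null eta : null_conf eta -> simple_conf eta.
Proof. by move=> eta0 x; rewrite (null_confE _ eta0). Qed.

Lemma boltzmann_null beta M eta : null_conf eta -> M eta = 0 ->
  boltzmann Lambda beta M eta = 1%E.
Proof.
move=> eta0 Meta; rewrite /boltzmann /Hen asboolT; last exact: simple_null.
by rewrite Rint_null// mulr0 Meta adde0 mule0 oppe0 expeR0.
Qed.

Lemma Bin0 B : Bin 0 mL B = \d_(@emptyconf R) B.
Proof. by rewrite /Bin /distribution /pushforward/= !diracE; congr (_%:R%:E). Qed.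

Lemma is_Mov_lim_null gamma : null_conf gamma -> is_Mov_lim mL gamma (cst 0).
Proof.
move=> g0; rewrite /is_Mov_lim null_conf_npts// conf_n0E.
rewrite (_ : (fun p => _) = cst 0%E); first exact: cvg_cst.
apply/funext => p /=.
have MovE eta : null_conf eta -> `|Mov mL p eta gamma - 0|%:E = 0%E.
  by move=> eta0; rewrite Mov_null// subr0 normr0.
rewrite (_ : [set _ | _ in _] = [set 0%E]) ?ereal_sup1//.
apply/seteqP; split => [_ [eta /MovE e <-]//|_ ->].
by exists emptyconf => //; rewrite MovE.
Qed.

Lemma is_Mov_lim_null0 gamma M eta : null_conf gamma -> is_Mov_lim mL gamma M ->
  null_conf eta -> M eta = 0.
Proof.
move=> g0 Mlim eta0; apply: (is_Mov_lim_unique Mlim (is_Mov_lim_null g0)).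
by rewrite null_conf_npts// conf_n0E.
Qed.

Lemma integral_boltzmann_null beta M B : measurable B ->
  (forall eta, null_conf eta -> M eta = 0) ->
  (\int[Bin 0 mL]_(eta in conf_n 0 Lambda `&` B) boltzmann Lambda beta M eta =
   \d_(@emptyconf R) B)%E.
Proof.
move=> mB M0; rewrite conf_n0E.
have mN := @measurable_null_conf R.
transitivity (\int[Bin 0 mL]_(eta in null_conf `&` B) (cst 1 eta))%E.
  by apply: eq_integral => eta; rewrite inE => -[eta0 _]; rewrite boltzmann_null// M0.
rewrite integral_cst; last exact: measurableI.
rewrite mul1e [LHS]Bin0 !diracE; congr (_%:R%:E); congr nat_of_bool.
by apply/idP/idP; rewrite !inE; [case|].
Qed.

Lemma partition_fun_null beta M : (forall eta, null_conf eta -> M eta = 0) ->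
  partition_fun mL beta M 0 = 1%E.
Proof.
by move=> /(integral_boltzmann_null beta measurableT); rewrite setIT diracT.
Qed.

Lemma admissible_null beta gamma : null_conf gamma -> admissible mL beta gamma.
Proof.
move=> g0; exists (cst 0); split; first exact: is_Mov_lim_null.
by rewrite null_conf_npts// partition_fun_null// lte01 ltry.
Qed.

(** With no points both energies are 0 and the weight is 1, so the kernel reduces to the binomial
    law of order 0. This forces the value of [mix_kernel] at null configurations. *)
Lemma gibbs_null beta gamma M B : null_conf gamma -> is_Mov_lim mL gamma M ->
  measurable B -> gibbs mL beta M (npts gamma Lambda) B = \d_(@emptyconf R) B.
Proof.
move=> g0 Mlim mB; have M0 eta := @is_Mov_lim_null0 gamma M eta g0 Mlim.
rewrite null_conf_npts// /gibbs partition_fun_null//.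
by rewrite integral_boltzmann_null//= invr1 mul1e.
Qed.

End null_configurations.

(** * Null sets and integrals of the mixture *)

Section mixture.
Context {R : realType}.
Variable P : probability (Conf R) R.
Local Open Scope ereal_scope.
Local Notation Pmix := (mix (compressed2 P)).

Lemma mixE A : Pmix A =
  (2^-1)%:E * \d_(@emptyconf R) A + (2^-1)%:E * P (@comp2 R @^-1` A).
Proof. exact: measure_addE. Qed.

(** An exceptional set of P may contain null configurations, which the mixture charges; once they
    are removed only the compressed component counts. *)
Lemma mix_negligible S : P.-negligible S ->
  Pmix.-negligible ((@dil2 R @^-1` S) `\` @null_conf R).
Proof.
move=> [N [mN PN SN]]; exists ((@dil2 R @^-1` N) `\` @null_conf R); split.
- apply: measurableD; last exact: measurable_null_conf.
  by rewrite -[X in measurable X]setTI; exact: measurable_dil2.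
- rewrite [LHS]mixE diracE memNset ?mule0 ?add0e; last by move=> [_]; apply.
  rewrite (_ : P _ = 0) ?mule0//.
  have -> : @comp2 R @^-1` ((@dil2 R @^-1` N) `\` @null_conf R) = N `\` @null_conf R.
    by apply/seteqP; split => g /=; rewrite comp2K.
  apply/eqP; rewrite eq_le measure_ge0 andbT -PN le_measure ?inE//.
  by apply: measurableD => //; exact: measurable_null_conf.
- by move=> g [/SN].
Qed.

(** The Dirac mass is evaluated through the Borel set [null_conf], which explains the requirement
    that f be constant there. *)
Lemma lower_integral_mix (f : Conf R -> \bar R) : (forall g, 0 <= f g) ->
  (forall g, null_conf g -> f g = f emptyconf) ->
  \int[Pmix]_g f g = (2^-1)%:E * f emptyconf + (2^-1)%:E * \int[P]_g f (comp2 g).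
Proof.
move=> f0 fnull.
rewrite [LHS]lower_integral_measure_add// !lower_integral_mscale//; congr (_ * _ + _ * _).
  rewrite (@lower_integral_null _ _ _ _ (~` @null_conf R) _ (cst (f emptyconf)))//.
  - by rewrite integral_dirac// diracT mul1e.
  - by apply: measurableC; exact: measurable_null_conf.
  - by rewrite /= diracE memNset//; apply.
  - by move=> x; exact: f0.
  - by move=> x /= /contrapT /fnull.
exact: (@integral_bij _ _ _ _ _ _ _ (@measurable_comp2 R) measurable_dil2 (@comp2K R) (@dil2K R)).
Qed.

End mixture.

(** * Integrals of bounded, possibly non-measurable functions *)

Section bounded_integral.
Context d (T : measurableType d) (R : realType).
Variable P : probability T R.
Local Open Scope ereal_scope.

Lemma bounded_fine (x : \bar R) (K : R) : 0 <= x <= K%:E ->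
  exists2 r, x = r%:E & (0 <= r <= K)%R.
Proof.
by case: x => [r rK| |/andP[]]; [exists r|rewrite leye_eq andbF|rewrite leeNy_eq].
Qed.

Lemma lower_integral_bounded (f : T -> \bar R) (K : R) :
  (forall x, 0 <= f x <= K%:E) -> 0 <= \int[P]_x f x <= K%:E.
Proof.
move=> fK; have f0 x : 0 <= f x by case/andP: (fK x).
rewrite integral_ge0//=; apply: (@le_trans _ _ (\int[P]_x (cst K%:E x))).
  by apply: le_lower_integral => // x; case/andP: (fK x).
by rewrite integral_cst// [X in _ * X](probability_setT P) mule1.
Qed.

Lemma funeposneg_bounded (f : T -> \bar R) (K : R) : (forall x, `|f x| <= K%:E) ->
  (forall x, 0 <= f^\+ x <= K%:E) /\ (forall x, 0 <= f^\- x <= K%:E).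
Proof.
move=> fK; have K0 (x : T) : 0 <= K%:E by exact: le_trans (abse_ge0 (f x)) (fK x).
by split=> x; rewrite ?funeposE ?funenegE le_max lexx orbT ge_max (K0 x) andbT;
  apply: le_trans (fK x); [exact: lee_abs|rewrite -abseN; exact: lee_abs].
Qed.

(** The lower integrals of the two parts both lie in [0, K], so their difference lies in [-K, K]. *)
Lemma integral_bounded (D : set T) (f : T -> \bar R) (K : R) : (0 <= K)%R ->
  (forall x, `|f x| <= K%:E) -> `|\int[P]_(x in D) f x| <= K%:E.
Proof.
move=> K0 fK; rewrite integral_mkcond.
have fDK x : `|(f \_ D) x| <= K%:E.
  by rewrite patchE; case: ifP; rewrite ?fK// abse0 lee_fin.
have [fp fn] := funeposneg_bounded fDK; rewrite integralE.
have /bounded_fine[b -> /andP[b0 bK]] := lower_integral_bounded fn.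
have /bounded_fine[a -> /andP[a0 aK]] := lower_integral_bounded fp.
rewrite -EFinB lee_fin ler_norml.
by apply/andP; split; lra.
Qed.

End bounded_integral.

Section mixture_integral.
Context {R : realType}.
Variable P : probability (Conf R) R.
Local Open Scope ereal_scope.
Local Notation Pmix := (mix (compressed2 P)).

(** The two parts of f are split separately; the bound makes all terms finite, so that their
    differences can be regrouped. *)
Lemma integral_mix (f : Conf R -> \bar R) (K : R) : (forall g, `|f g| <= K%:E) ->
  (forall g, null_conf g -> f g = f emptyconf) ->
  \int[Pmix]_g f g = (2^-1)%:E * f emptyconf + (2^-1)%:E * \int[P]_g f (comp2 g).
Proof.
move=> fK fnull.
have [fp fn] := funeposneg_bounded fK.
have -> : f emptyconf = f^\+ emptyconf - f^\- emptyconf by rewrite {1}(funeposneg f).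
rewrite integralE [X in _ = _ + _ * X]integralE.
have fnullp g : null_conf g -> f^\+ g = f^\+ emptyconf.
  by move=> /fnull fg; rewrite !funeposE fg.
have fnulln g : null_conf g -> f^\- g = f^\- emptyconf.
  by move=> /fnull fg; rewrite !funenegE fg.
rewrite (lower_integral_mix P _ fnullp); last by move=> g; case/andP: (fp g).
rewrite (lower_integral_mix P _ fnulln); last by move=> g; case/andP: (fn g).
have -> : (fun g => f (comp2 g))^\+ = (fun g => f^\+ (comp2 g)).
  by apply/funext => g; rewrite !funeposE.
have -> : (fun g => f (comp2 g))^\- = (fun g => f^\- (comp2 g)).
  by apply/funext => g; rewrite !funenegE.
have /bounded_fine[a -> _] := fp emptyconf.
have /bounded_fine[b -> _] := fn emptyconf.
have /bounded_fine[c -> _] := lower_integral_bounded P (fun g => fp (comp2 g)).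
have /bounded_fine[e -> _] := lower_integral_bounded P (fun g => fn (comp2 g)).
rewrite -!EFinB -!EFinM -!EFinD; congr _%:E; lra.
Qed.

End mixture_integral.

(** * The canonical sigma-field under dilation *)

Section canonical_sigma_field.
Context {R : realType}.
Local Notation half := ((fun x => x / 2) : measurableTypeR R -> measurableTypeR R).
Implicit Types (Lambda : set (measurableTypeR R)).

Lemma Fcan_measurable Lambda (mL : measurable Lambda) : Fcan Lambda `<=` measurable.
Proof.
apply: smallest_sub; first exact: sigma_algebra_measurable.
move=> _ [[B [Y [mB _ _ mY ->]]]|[Y mY ->]]; rewrite -[X in measurable X]setTI.
- exact: measurable_conf_ev.
- exact: measurable_conf_ev.
Qed.

(** Emptiness is read off the count in Lambda and the counts in bounded pieces of its complement.
    Hence a kernel may be defined by cases on [null_conf] without leaving the canonical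
    sigma-field. *)
Lemma Fcan_null_conf Lambda : measurable Lambda -> Fcan Lambda (@null_conf R).
Proof.
move=> mL; pose G : set (set (Conf R)) := count_events (~` Lambda) `|`
      [set C | exists2 Y : set (\bar R), measurable Y &
         C = [set gamma : Conf R | Y (gamma Lambda)]].
pose U k : set (measurableTypeR R) := box k `\` Lambda.
have mU k : measurable (U k) by apply: measurableD => //; exact: measurable_itv.
have -> : @null_conf R = [set g | g Lambda = 0%E] `&` \bigcap_k [set g | g (U k) = 0%E].
  apply/seteqP; split => [g g0|g [gL gU]].
    by split=> [|k _]; exact: null_confE.
  have TE : (setT : set (measurableTypeR R)) = Lambda `|` \bigcup_k U k.
    apply/seteqP; split => // x _; have [Lx|nLx] := pselect (Lambda x); [by left|right].
    have := truncnS_gt (`|x| * 2); set m := Num.truncn _ => hm.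
    exists m.+1 => //; split => //; rewrite /box/= in_itv/= -ler_norml.
    by rewrite ler_pdivlMr// ltW.
  apply/negligibleP => //; rewrite TE; apply: negligibleU; first exact/negligibleP.
  by apply: negligible_bigcup => k; apply/negligibleP => //; exact: gU.
suff : @measurable _ (g_sigma_algebraType G)
  ([set g | g Lambda = 0%E] `&` \bigcap_k [set g | g (U k) = 0%E]) by [].
apply: measurableI; last apply: bigcapT_measurable => k.
  apply: sub_sigma_algebra; right; exists [set 0%E]; last by [].
  exact: emeasurable_set1.
apply: sub_sigma_algebra; left; exists (U k), [set 0%E]; split => //.
- apply/bounded_setE; exists (k%:R / 2) => x [] + _.
  by rewrite /box/= in_itv/= -ler_norml.
- by move=> x [].
Qed.

(** Generators pull back to generators: bounded sets outside the doubled window are halved into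
    bounded sets outside Lambda. *)
Lemma Fcan_dil2 Lambda S : Fcan (half @^-1` Lambda) S -> Fcan Lambda (@dil2 R @^-1` S).
Proof.
move: S; rewrite -[forall S, _]/(Fcan (half @^-1` Lambda) `<=` [set S | Fcan Lambda (@dil2 R @^-1` S)]).
apply: smallest_sub.
  have [h1 h2 h3] := @smallest_sigma_algebra _ setT (count_events (~` Lambda) `|`
      [set C | exists2 Y : set (\bar R), measurable Y &
         C = [set gamma : Conf R | Y (gamma Lambda)]]).
  split => /=; [exact: h1| |by move=> F /h3].
  by move=> A /h2; rewrite !setTD.
move=> _ [[B [Y [mB bB BL mY ->]]]|[Y mY ->]].
- apply: sub_sigma_algebra; left; exists ((fun x => x * 2) @^-1` B), Y; split => //.
  + rewrite -[X in measurable X]setTI.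
    by apply: continuous_measurable_fun => // x; apply: cvgM; [exact: cvg_id|exact: cvg_cst].
  + exact: bounded_double.
  + by move=> x /= /BL /=; rewrite mulfK.
- apply: sub_sigma_algebra; right; exists Y => //.
  apply/funext => g /=; rewrite dil2E; congr (Y (g _)).
  by apply/seteqP; split => x /=; rewrite mulfK.
Qed.

End canonical_sigma_field.

(** * The DLR equations for the mixture *)

Section mixture_DLR.
Context {R : realType}.
Variable P : probability (Conf R) R.
Local Notation Pmix := (mix (compressed2 P)).
Local Notation half := ((fun x => x / 2) : measurableTypeR R -> measurableTypeR R).
Local Notation comp2 := (@comp2 R).
Local Notation dil2 := (@dil2 R).

Let mdil2 (A : set (Conf R)) : measurable A -> measurable (dil2 @^-1` A).
Proof. by move=> mA; rewrite -[X in measurable X]setTI; exact: measurable_dil2. Qed.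

Let dil2P (Q : probability (Conf R) R) : exists Q' : probability (Conf R) R,
  forall A, Q' A = Q (dil2 @^-1` A).
Proof.
pose f : {mfun Conf R >-> Conf R} := mfun_Sub (mem_set measurable_dil2).
by exists (distribution Q f).
Qed.

(** For a law Q, bracket A by Borel sets under the image of Q by [dil2] and pull the bracket
    back. *)
Lemma universally_measurable_dil2 (A : set (Conf R)) : universally_measurable A ->
  universally_measurable (dil2 @^-1` A `|` @null_conf R).
Proof.
move=> uA Q; have [Q' Q'E] := dil2P Q.
have [B [C [mB mC BA AC CB]]] := uA Q'.
have mN := @measurable_null_conf R.
exists (dil2 @^-1` B `|` @null_conf R), (dil2 @^-1` C `|` @null_conf R); split.
- by apply: measurableU => //; exact: mdil2.
- by apply: measurableU => //; exact: mdil2.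
- by move=> g [/BA|]; [left|right].
- by move=> g [/AC|]; [left|right].
- apply/eqP; rewrite eq_le measure_ge0 andbT -CB Q'E le_measure ?inE//.
  + by apply: measurableD; apply: measurableU => //; exact: mdil2.
  + by apply: mdil2; exact: measurableD.
  + by move=> g [[Cg|g0] nB]; [split=> // Bg; apply: nB; left|case: nB; right].
Qed.

Section kernel.
Variables (Lambda : set (measurableTypeR R)) (mL : measurable Lambda).
Variable K2 : Conf R -> probability (Conf R) R.

(* The kernel K2 of P is unconstrained on a P-null set, which may contain the
   empty configuration, an atom of the mixture; hence the separate value. *)
Definition mix_kernel (gamma : Conf R) : probability (Conf R) R :=
  match pselect (null_conf gamma) return probability (Conf R) R with
  | left _ => @dirac _ (Conf R) emptyconf R
  | right _ => distribution (K2 (dil2 gamma)) comp2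
  end.

Lemma mix_kernel_null gamma A : null_conf gamma ->
  mix_kernel gamma A = \d_(@emptyconf R) A.
Proof. by rewrite /mix_kernel; case: pselect. Qed.

Lemma mix_kernelE gamma A : ~ null_conf gamma ->
  mix_kernel gamma A = K2 (dil2 gamma) (comp2 @^-1` A).
Proof. by rewrite /mix_kernel; case: pselect. Qed.

(** On [null_conf] the kernel is constant, so the event there is everything or nothing, as recorded
    by W. Off it, the bracket for [K2] is pulled back by [dil2]. *)
Lemma mix_kernel_completion B Y : measurable B -> measurable Y ->
  completion (Fcan (half @^-1` Lambda)) P [set gamma | Y (K2 gamma (comp2 @^-1` B))] ->
  completion (Fcan Lambda) Pmix [set gamma | Y (mix_kernel gamma B)].
Proof.
move=> mB mY [B0 [C0 [FB FC BS SC CB]]].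
have mL2 : measurable (half @^-1` Lambda).
  by rewrite -[X in measurable X]setTI; exact: measurable_half.
pose G := count_events (~` Lambda) `|`
      [set C | exists2 Y : set (\bar R), measurable Y &
         C = [set gamma : Conf R | Y (gamma Lambda)]].
have mN : @measurable _ (g_sigma_algebraType G) (@null_conf R) by exact: Fcan_null_conf.
pose W : set (Conf R) := [set _ | Y (\d_(@emptyconf R) B)].
have mW : @measurable _ (g_sigma_algebraType G) W.
  rewrite /W; have [YB|nYB] := pselect (Y (\d_(@emptyconf R) B)).
    rewrite (_ : [set _ | _] = setT); first exact: measurableT.
    by apply/seteqP; split.
  rewrite (_ : [set _ | _] = set0); first exact: measurable0.
  by apply/seteqP; split.
have F S : Fcan (half @^-1` Lambda) S ->
    @measurable _ (g_sigma_algebraType G) ((@null_conf R `&` W) `|` (dil2 @^-1` S `\` @null_conf R)).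
  move=> FS; apply: measurableU; first exact: measurableI.
  by apply: measurableD => //; exact: Fcan_dil2.
exists ((@null_conf R `&` W) `|` (dil2 @^-1` B0 `\` @null_conf R)).
exists ((@null_conf R `&` W) `|` (dil2 @^-1` C0 `\` @null_conf R)).
split; [exact: F|exact: F| | |].
- move=> g [[g0 Wg]|[Bg g0]] /=; first by rewrite mix_kernel_null.
  by rewrite mix_kernelE//; exact: BS.
- move=> g /= Yg; have [g0|g0] := pselect (null_conf g).
    by left; split => //; rewrite mix_kernel_null in Yg.
  by right; split => //; apply: SC => /=; rewrite mix_kernelE in Yg.
- have mC0 := Fcan_measurable mL2 FC; have mB0 := Fcan_measurable mL2 FB.
  have h : Pmix.-negligible ((dil2 @^-1` (C0 `\` B0)) `\` @null_conf R).
    by apply: mix_negligible; apply/negligibleP => //; exact: measurableD.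
  apply/negligibleP.
    by apply: measurableD; apply: (Fcan_measurable mL); exact: F.
  apply: negligibleS h => g [[[g0 Wg]|[Cg g0]] nB]; first by case: nB; left.
  by split => //; split => // Bg; apply: nB; right.
Qed.

Lemma integral_mix_kernel gamma (D : set (Conf R)) (f : Conf R -> \bar R) :
  ~ null_conf gamma -> (\int[mix_kernel gamma]_(eta in D) f eta =
  \int[K2 (dil2 gamma)]_(eta in comp2 @^-1` D) f (comp2 eta))%E.
Proof.
move=> g0; apply: (@integral_bij _ _ _ _ _ _ _ (@measurable_comp2 R) measurable_dil2 (@comp2K R) (@dil2K R)).
by move=> A _; exact: mix_kernelE.
Qed.

(** The Dirac mass ignores what happens off [null_conf]. On it, the glued configuration vanishes on
    Borel sets, so the measurable F cannot tell it from [emptyconf]. *)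
Lemma integral_mix_kernel_null gamma (F : Conf R -> R) :
  measurable_fun setT F -> null_conf gamma ->
  (\int[mix_kernel gamma]_(eta in conf_in Lambda)
     (F (addconf eta (restconf (measurableC mL) gamma)))%:E = (F emptyconf)%:E)%E.
Proof.
move=> mF g0.
rewrite integral_mkcond (_ : mix_kernel gamma = @dirac _ (Conf R) emptyconf R); last first.
  by rewrite /mix_kernel; case: pselect.
have mN := @measurable_null_conf R.
transitivity (\int[@dirac _ (Conf R) emptyconf R]_eta (cst (F emptyconf)%:E eta))%E; last first.
  by rewrite integral_dirac// diracT mul1e.
rewrite integralE [RHS]integralE.
have d0 : \d_(@emptyconf R) (~` @null_conf R) = 0%E :> \bar R.
  by rewrite diracE memNset//; apply.
have fE eta : null_conf eta ->
    ((fun eta => (F (addconf eta (restconf (measurableC mL) gamma)))%:E) \_ (conf_in Lambda)) eta =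
    (F emptyconf)%:E.
  move=> eta0; rewrite patchE mem_set; last first.
    by apply: (null_confE _ eta0); exact: measurableC.
  congr (_%:E); apply: measurable_fun_conf_indist => // A mA.
  rewrite [LHS]measure_addE (null_confE mA eta0) add0e.
  by apply: (null_confE _ g0); apply: measurableI => //; exact: measurableC.
congr (_ - _)%E.
- apply: (lower_integral_null _ d0) => //; first exact: measurableC.
  by move=> eta /contrapT eta0; rewrite !funeposE fE.
- apply: (lower_integral_null _ d0) => //; first exact: measurableC.
  by move=> eta /contrapT eta0; rewrite !funenegE fE.
Qed.

End kernel.

Lemma integral_ae_eq_null (N : set (Conf R)) (f h : Conf R -> \bar R) :
  measurable N -> P N = 0%E -> (forall g, ~ N g -> f g = h g) ->
  (\int[P]_g f g = \int[P]_g h g)%E.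
Proof.
move=> mN PN fh; rewrite integralE [RHS]integralE; congr (_ - _)%E.
- by apply: (lower_integral_null mN PN) => // g /fh fg; rewrite !funeposE fg.
- by apply: (lower_integral_null mN PN) => // g /fh fg; rewrite !funenegE fg.
Qed.

Theorem canonical_DLR_mix beta : P (@null_conf R) = 0%E ->
  canonical_DLR beta P -> canonical_DLR beta Pmix.
Proof.
move=> P0 dlr Lambda mL bL L0.
have mL2 : measurable (half @^-1` Lambda).
  by rewrite -[X in measurable X]setTI; exact: measurable_half.
have L20 : (0 < lebesgue_measure (half @^-1` Lambda))%E.
  by rewrite lebesgue_measure_half// mule_gt0.
have [A2 [uA2 nA2 A2adm [K2 [K2L K2gibbs K2mes K2dlr]]]] := dlr _ mL2 (bounded_half bL) L20.
(* Null configurations must be included, as the mixture charges them and [A2] may omit them. *)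
exists (dil2 @^-1` A2 `|` @null_conf R); split.
- exact: universally_measurable_dil2.
- apply: negligibleS (mix_negligible nA2) => g ng; split => /=.
    by move=> Ag; apply: ng; left.
  by move=> g0; apply: ng; right.
- move=> g [Ag|g0]; last exact: admissible_null.
  by rewrite -[g]dil2K; apply: (admissible_comp2 _ bL (mL2 := mL2)); exact: A2adm.
exists (mix_kernel K2); split.
- move=> g; have [g0|g0] := pselect (null_conf g).
    rewrite mix_kernel_null// diracE mem_set//.
  by rewrite mix_kernelE//; exact: K2L.
- move=> g M Ag Mlim B mB; have [g0|g0] := pselect (null_conf g).
    by rewrite mix_kernel_null// (gibbs_null beta g0 Mlim mB).
  rewrite mix_kernelE//; case: Ag => // Ag.
  (* The given M lives in the window Lambda, while [K2gibbs] asks for a limit in the doubled one.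
     Admissibility supplies [M2]; uniqueness of limits identifies M with its transport. *)
  have [M2 [M2lim _]] := A2adm _ Ag.
  have mB2 : measurable (comp2 @^-1` B).
    by rewrite -[X in measurable X]setTI; exact: measurable_comp2.
  rewrite (K2gibbs _ _ Ag M2lim _ mB2).
  have := is_Mov_lim_comp2 mL bL M2lim; rewrite dil2K => M'lim.
  rewrite (@eq_gibbs _ _ mL beta M (M2 \o dil2)); last first.
    by move=> eta; exact: is_Mov_lim_unique.
  rewrite (gibbs_comp2 mL bL mL2).
  have -> : ((M2 \o dil2) \o comp2) = M2 by apply/funext => eta /=; rewrite comp2K.
  by rewrite -[in RHS](dil2K g).
- move=> B Y mB mY; apply: mix_kernel_completion => //; apply: K2mes => //.
  by rewrite -[X in measurable X]setTI; exact: measurable_comp2.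
- move=> F mF bF.
  have [K K0 FK] : exists2 K : R, 0 <= K & forall g, `|F g| <= K.
    have [K K0 FK] := pinfty_ex_gt0 bF.
    by exists K; [exact: ltW|move=> g; exact: FK].
  have FnullE g : null_conf g -> F g = F emptyconf.
    by move=> g0; apply: measurable_fun_conf_indist => // A mA; rewrite (null_confE mA g0).
  rewrite (@integral_mix _ _ _ K)//; last by move=> g /FnullE ->.
  rewrite (@integral_mix _ _ _ K)//; last first.
  + by move=> g g0; rewrite !integral_mix_kernel_null.
  + by move=> g; apply: integral_bounded => // eta; exact: FK.
  rewrite integral_mix_kernel_null//; congr (_ + _ * _)%E.
  have mF2 : measurable_fun setT (F \o comp2).
    by apply: measurableT_comp => //; exact: measurable_comp2.
  have bF2 : bounded_fun (F \o comp2).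
    by exists K; split; [exact: num_real|move=> N KN g _; exact: le_trans (FK _) (ltW KN)].
  rewrite (K2dlr _ mF2 bF2).
  (* At a null g the kernel has been overwritten and the two integrands may differ; by [P0] this
     does not affect the integral. *)
  apply: (integral_ae_eq_null (@measurable_null_conf R) P0) => g g0.
  rewrite integral_mix_kernel//.
  rewrite comp2K; apply: eq_integral => eta _ /=; congr (F _)%:E.
  apply: conf_ext => A; rewrite [LHS]measure_addE; exact/esym/measure_addE.
Qed.

End mixture_DLR.

(** * Simplicity from the DLR equations *)

Section simplicity.
Context {R : realType}.
Implicit Types (g : Conf R) (A D : set (measurableTypeR R)).

Definition rat_itv n (q : rat) : set (measurableTypeR R) :=
  `]ratr q - n.+1%:R^-1, ratr q + n.+1%:R^-1[%classic.

Lemma measurable_rat_itv n q : measurable (rat_itv n q).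
Proof. exact: measurable_itv. Qed.
Local Hint Resolve measurable_rat_itv : core.

(* A measurable way to say that a point of D has multiplicity at least 2. *)
Definition crowded D : set (Conf R) := \bigcap_n \bigcup_(q : rat)
  [set g | 2%:E <= g (D `&` rat_itv n q)]%E.

Lemma measurable_crowded D : measurable D -> measurable (crowded D).
Proof.
move=> mD; apply: bigcapT_measurable => n; apply: countable_bigcupT_measurable => // q.
have mI : measurable (D `&` rat_itv n q).
  exact: measurableI.
rewrite -[X in measurable X]setTI.
exact: (emeasurable_fun_c_infty measurableT (measurable_conf_ev mI)).
Qed.

Lemma eq_crowded D g1 g2 : measurable D ->
  (forall A, measurable A -> A `<=` D -> g1 A = g2 A) -> crowded D g1 -> crowded D g2.
Proof.
move=> mD g12 cg n _; have [q _ /= gq] := cg n I.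
by exists q => //=; rewrite -g12//; exact: measurableI.
Qed.

Lemma near_all_seq (T : eqType) (s : seq T) (Q : T -> nat -> Prop) :
  (forall x, \forall n \near \oo, Q x n) ->
  \forall n \near \oo, forall x, x \in s -> Q x n.
Proof.
move=> Qn; elim: s => [|x s IH]; first exact: nearW.
near=> n => y; rewrite inE => /predU1P[->|ys]; first by near: n.
by move: y ys; near: n.
Unshelve. all: by end_near. Qed.

(** A simple configuration has finitely many points in D, hence a positive least distance; short
    enough intervals contain at most one of them. *)
Lemma crowded_not_simple D g : measurable D -> bounded_set (D : set R) ->
  crowded D g -> ~ simple_conf g.
Proof.
move=> mD bD cg simp; have [s sD gs] := conf_atoms g mD bD.
have us := simple_atoms_uniq sD gs simp.
(* Half the distance, because [rat_itv] has radius, not length, [n.+1%:R^-1]. *)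
have [N _ NP] : \forall n \near \oo, forall xy : R * R, xy \in [seq (x, y) | x <- s, y <- s] ->
    xy.1 != xy.2 -> n.+1%:R^-1 < `|xy.1 - xy.2| / 2.
  apply: near_all_seq => -[x y] /=; have [->|xy] := eqVneq x y; first exact: nearW.
  have d0 : 0 < `|x - y| / 2 by rewrite divr_gt0// normr_gt0 subr_eq0.
  by have := near_infty_natSinv_lt (PosNum d0); apply: filterS.
have {NP} := NP N (leqnn N) => NP.
have [q _ /=] := cg N I.
set J := rat_itv _ _; rewrite gs; [|apply: measurableI => //; exact: measurable_rat_itv|exact: subIsetl].
rewrite conf_of_seqE lee_fin ler_nat -size_filter.
have := filter_uniq (mem (D `&` J)) us.
move E : [seq _ <- _ | _] => t.
case: t E => [|x [|y t]] E //= /andP[+ _] _.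
rewrite inE negb_or => /andP[xy _].
have /andP[xs Jx] : (x \in s) && (x \in D `&` J).
  by rewrite andbC -mem_filter E inE eqxx.
have /andP[ys Jy] : (y \in s) && (y \in D `&` J).
  by rewrite andbC -mem_filter E !inE eqxx orbT.
have := NP (x, y) _ xy.
move: Jx Jy; rewrite !inE /J/rat_itv/= !in_itv/=.
move=> -[_ /andP[x1 x2]] [_ /andP[y1 y2]] /(_ (allpairs_f _ xs ys)).
rewrite ltNge => /negP; apply.
rewrite ler_pdivrMr// ler_norml; move: x1 x2 y1 y2.
by move: (ratr q) (N.+1%:R^-1) => c r ? ? ? ?; apply/andP; split; lra.
Qed.

Lemma not_simple_crowded D g x : measurable D -> D x -> ~ (g [set x] <= 1)%E -> crowded D g.
Proof.
move=> mD Dx gx n _.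
have xn : x - n.+1%:R^-1 < x + n.+1%:R^-1.
  by rewrite ltrBlDr -addrA ltrDl addr_gt0 ?invr_gt0 ?ltr0n.
have [q] := rat_in_itvoo xn.
rewrite in_itv/= => /andP[q1 q2]; exists q => //=.
apply: (@le_trans _ _ (g [set x])).
  have bx : bounded_set ([set x] : set R).
    by apply/bounded_setE; exists `|x| => y ->.
  have [m gm] := confP g (measurable_set1 x) bx.
  move: gx; rewrite gm !lee_fin => /negP; rewrite -ltNge.
  by rewrite -[1]/(1%:R) ltr_nat ler_nat.
apply: le_measure; rewrite ?inE; [exact: measurable_set1|by apply: measurableI|].
by move=> _ ->; split => //=; rewrite /rat_itv/= in_itv/= ltrBlDr q2 -ltrBlDr q1.
Qed.

Lemma boltzmann_not_simple D beta (M : Conf R -> R) eta : 0 < beta ->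
  ~ simple_conf eta -> boltzmann D beta M eta = 0%E.
Proof.
move=> b0 neta; rewrite /boltzmann /Hen asboolF// addye//.
by rewrite gt0_muley ?lte_fin.
Qed.

(** The equations are tested on the indicator of [crowded D]. It depends only on the restriction to
    D, so the inner integral is the Gibbs mass of the event, on which the Boltzmann weight
    vanishes. *)
Lemma canonical_DLR_crowded beta (P : probability (Conf R) R) D : 0 < beta ->
  canonical_DLR beta P -> measurable D -> bounded_set (D : set R) ->
  (0 < lebesgue_measure D)%E -> P (crowded D) = 0%E.
Proof.
move=> b0 dlr mD bD D0.
have [A [_ nA Aadm [K [KD Kgibbs _ Kdlr]]]] := dlr D mD bD D0.
have mC := measurable_crowded mD.
have bF : bounded_fun (\1_(crowded D) : Conf R -> R).
  exists 1; split; first exact: num_real.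
  by move=> N N1 g _; rewrite /= indicE; case: (_ \in _); rewrite ?normr1 ?normr0 ltW// (lt_trans _ N1).
have mF : measurable_fun setT (\1_(crowded D) : Conf R -> R) by exact: measurable_indic.
have := Kdlr _ mF bF; rewrite integral_indic// setIT => ->.
have [N [mN PN AN]] := nA.
have inner g : (\int[K g]_(eta in conf_in D)
    (\1_(crowded D) (addconf eta (restconf (measurableC mD) g)))%:E =
    K g (crowded D `&` conf_in D))%E.
  rewrite -integral_indic//; last first.
    rewrite -[X in measurable X]setTI.
    exact: (measurable_conf_ev (measurableC mD) measurableT (emeasurable_set1 0%E)).
  apply: eq_integral => eta _; congr (_%:E); rewrite !indicE; congr (_%:R).
  have E B : measurable B -> B `<=` D -> addconf eta (restconf (measurableC mD) g) B = eta B.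
    move=> mB BD; rewrite [LHS]measure_addE /= /mrestr (_ : B `&` ~` D = set0) ?measure0 ?adde0//.
    by rewrite setIC; apply/disjoints_subset => // x nDx Bx; exact/nDx/BD.
  congr nat_of_bool; apply/idP/idP; rewrite !inE; apply: eq_crowded => // B mB BD.
  by rewrite E.
rewrite (lower_integral_null mN PN (h := cst 0%E))//.
- by rewrite integral0.
- by move=> g; rewrite inner measure_ge0.
- move=> g Ng; have Ag : A g by apply: contrapT => /AN.
  rewrite inner; apply/eqP; rewrite eq_le measure_ge0 andbT.
  apply: (@le_trans _ _ (K g (crowded D))).
    apply: le_measure; rewrite ?inE//; apply: measurableI => //.
    rewrite -[X in measurable X]setTI.
    exact: (measurable_conf_ev (measurableC mD) measurableT (emeasurable_set1 0%E)).
  have [M [Mlim _]] := Aadm _ Ag.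
  rewrite (Kgibbs _ _ Ag Mlim _ mC) /gibbs integral0_eq ?mule0// => eta [_ ceta].
  by apply: boltzmann_not_simple => //; exact: crowded_not_simple ceta.
Qed.

Lemma canonical_DLR_simple beta (P : probability (Conf R) R) : 0 < beta ->
  canonical_DLR beta P -> {ae P, forall g, simple_conf g}.
Proof.
move=> b0 dlr.
(* [box 0] is a point, of Lebesgue measure 0, to which the equations do not apply. *)
pose D k : set (measurableTypeR R) := box k.+1.
have mD k : measurable (D k) by exact: measurable_itv.
have bD k : bounded_set (D k : set R).
  by apply/bounded_setE; exists (k.+1%:R / 2) => x; rewrite /D/box/= in_itv/= -ler_norml.
have D0 k : (0 < lebesgue_measure (D k))%E.
  rewrite lebesgue_measure_itv/= lte_fin ifT; last by rewrite gtrN// divr_gt0.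
  by rewrite -EFinD lte_fin opprK addr_gt0// divr_gt0.
apply: (negligibleS _ (negligible_bigcup (F := fun k => crowded (D k)) _)); last first.
  by move=> k; apply/negligibleP; [exact: measurable_crowded|exact: (canonical_DLR_crowded b0)].
move=> g /= /existsNP[x gx].
have := truncnS_gt (`|x| * 2); set m := Num.truncn _ => hm.
exists m => //; apply: (not_simple_crowded (x := x)) => //.
by rewrite /D/box/= in_itv/= -ler_norml ler_pdivlMr// ltW.
Qed.

End simplicity.

(** * Infinite energy of the empty configuration *)

Section smooth_functions.
Context {R : realType}.
Implicit Types (f g : R -> R) (k n : nat).

(** One-variable counterpart of [Ck] with the derivative as an explicit witness, so that closure
    under sums, products and affine changes is a plain induction. *)
Fixpoint smooth k f : Prop :=
  match k with
  | 0%N => continuous f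
  | m.+1 => exists f', (forall x : R, is_derive x (1 : R) f (f' x)) /\ smooth m f'
  end.

Lemma derive_continuous f f' : (forall x : R, is_derive x (1 : R) f (f' x)) -> continuous f.
Proof.
move=> df x; apply: differentiable_continuous; apply/derivable1_diffP.
by have [] := df x.
Qed.

Lemma smooth_continuous k f : smooth k f -> continuous f.
Proof. by case: k => [//|k [f' [df _]]]; exact: derive_continuous df. Qed.

Lemma smoothW k f : smooth k.+1 f -> smooth k f.
Proof.
elim: k f => [|k IH] f [f' [df sf']]; first exact: derive_continuous df.
by exists f'; split => //; exact: IH.
Qed.

Lemma smooth_cst k (c : R) : smooth k (cst c).
Proof.
elim: k c => [|k IH] c /=; first by move=> x; exact: cvg_cst.
by exists (cst 0); split; [move=> x; exact: is_derive_cst|exact: IH].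
Qed.

Lemma smoothD k f g : smooth k f -> smooth k g -> smooth k (fun x => f x + g x).
Proof.
elim: k f g => [|k IH] f g /=.
  by move=> cf cg x; apply: cvgD; [exact: cf|exact: cg].
move=> [f' [df sf]] [g' [dg sg]]; exists (fun x => f' x + g' x); split; last exact: IH.
by move=> x; exact: is_deriveD.
Qed.

Lemma smoothM k f g : smooth k f -> smooth k g -> smooth k (fun x => f x * g x).
Proof.
elim: k f g => [|k IH] f g.
  by move=> cf cg x; apply: cvgM; [exact: cf|exact: cg].
move=> sf sg; have sf0 := smoothW sf; have sg0 := smoothW sg.
move: sf sg => [f' [df sf]] [g' [dg sg]].
exists (fun x => f x * g' x + g x * f' x); split; last by apply: smoothD; exact: IH.
by move=> x; exact: is_deriveM.
Qed.

Lemma smooth_affine k f (a b : R) : smooth k f -> smooth k (fun x => f (a * x + b)).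
Proof.
elim: k f => [|k IH] f.
  move=> cf x; apply: (@cvg_comp _ _ _ (fun x => a * x + b) f _ (nbhs (a * x + b))); last exact: cf.
  by apply: cvgD; [apply: cvgM; [exact: cvg_cst|exact: cvg_id]|exact: cvg_cst].
move=> [f' [df sf]]; exists (fun x => f' (a * x + b) * a); split; last first.
  by apply: smoothM; [exact: IH|exact: smooth_cst].
move=> x; apply: (@is_derive1_comp _ f (fun x => a * x + b)).
by apply: is_derive_eq; rewrite addr0; exact: mulr1.
Qed.

Lemma cvg_is_derive (V W : normedModType R) (f : V -> W) (a v : V) (l : W) :
  h^-1 *: ((f \o shift a) (h *: v) - f a) @[h --> (0 : R)^'] --> l -> is_derive a v f l.
Proof. by move=> fl; split; [apply/cvg_ex; exists l|exact/cvg_lim]. Qed.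

(* Derivatives of exp(-1/x) are combinations of these functions, by is_derive_flat. *)
Definition flat n (x : R) : R := if 0 < x then x^-1 ^+ n * expR (- x^-1) else 0.

(** With t = 1/x this is exp t >= t^(n+2) / (n+2)!. The square makes the difference quotients at 0
    tend to 0. *)
Lemma flat_bound n x : `|flat n x| <= n.+2`!%:R * x ^+ 2.
Proof.
rewrite /flat; case: ifPn => [x0|_]; last by rewrite normr0 mulr_ge0// sqr_ge0.
have t0 : 0 < x^-1 by rewrite invr_gt0.
rewrite ger0_norm; last by rewrite mulr_ge0 ?expR_ge0// exprn_ge0// ltW.
rewrite expRN ler_pdivrMr ?expR_gt0// -[x in x ^+ 2]invrK [_^-1 ^+ 2]exprVn.
set t := x^-1 in t0 *.
rewrite mulrAC ler_pdivlMr ?exprn_gt0// -exprD addn2 mulrC -ler_pdivrMr ?ltr0n ?fact_gt0//.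
by apply: le_trans (expR_ge1Dxn n.+1 (ltW t0)); rewrite ler_wpDl.
Qed.

Lemma is_derive_flat n x :
  is_derive x (1 : R) (flat n) (flat n.+2 x - n%:R * flat n.+1 x).
Proof.
have [x0|x0|->] := ltgtP x 0.
- rewrite /flat ltNge (ltW x0)/= mulr0 subr0.
  apply: (@near_eq_is_derive _ _ _ (cst 0)).
  near=> y; rewrite ltNge ltW//; near: y; exact: lt_nbhsl.
- rewrite /flat x0.
  refine (@near_eq_is_derive R R R (fun y : R => y^-1 ^+ n * expR (- y^-1)) _ x 1 _ _ _).
    by near=> y; rewrite ifT//; near: y; exact: lt_nbhsr.
  have dV : is_derive x (1 : R) (fun y : R => y^-1) (- x^-2 *: 1).
    by apply: is_deriveV; rewrite gt_eqF.
  have dX := is_deriveX n dV.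
  have dE : is_derive x (1 : R) (fun y : R => expR (- y^-1)) (expR (- x^-1) * - (- x^-2 *: 1)).
    by apply: (@is_derive1_comp _ expR).
  rewrite (_ : (fun y => _) = (fun y : R => y^-1) ^+ n * (fun y : R => expR (- y^-1))); last first.
    by apply/funext => y; rewrite -[RHS]/(_ * _) exprfctE.
  apply: (is_derive_eq (is_deriveM dX dE)).
  rewrite exprfctE /GRing.scale/= -exprVn.
  set t := x^-1; set e := expR _.
  have nt : n%:R * t ^+ n.-1 * t = n%:R * t ^+ n.
    by case: (n) => [|m]; rewrite ?mul0r// exprSr mulrA.
  rewrite !mulr1.
  transitivity (t ^+ n * e * t ^+ 2 - e * (n%:R * t ^+ n.-1 * t) * t); first by ring.
  by rewrite nt !(exprSr t n.+1) !(exprSr t n); ring.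
- have flat0 m : flat m 0 = 0 by rewrite /flat ltxx.
  rewrite !flat0 mulr0 subr0; apply: cvg_is_derive.
  have c0 : n.+2`!%:R * `|h| @[h --> (0 : R)^'] --> (0 : R).
    have c0 : {for 0, continuous (fun h : R => n.+2`!%:R * `|h| : R)}.
      apply: continuousM; first exact: cvg_cst.
      exact: norm_continuous.
    by rewrite /prop_for /continuous_at normr0 mulr0 in c0; move=> A /c0; exact: nbhs_dnbhs.
  apply/norm_cvg0P; apply: (squeeze_cvgr _ (cvg_cst 0) c0).
  near=> h; have h0 : h != 0 by near: h; exact: nbhs_dnbhs_neq.
  rewrite normr_ge0/= addr0 flat0 subr0 normrM normfV -ler_pdivlMl ?invr_gt0 ?normr_gt0// invrK.
  rewrite [h *: _]mulr1.
  apply: le_trans (flat_bound n h) _.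
  by rewrite -[h ^+ 2]real_normK ?num_real// expr2 mulrCA.
Unshelve. all: by end_near. Qed.

End smooth_functions.

(** * Test functions of product form *)

Section test_functions.
Context {R : realType}.
Local Notation e1 := ((1 : R), (0 : R)).
Local Notation e2 := ((0 : R), (1 : R)).
Implicit Types (f g : R -> R) (k n : nat).

Lemma smooth_flat k n : smooth k (@flat R n).
Proof.
elim: k n => [|k IH] n; first exact: (derive_continuous (@is_derive_flat R n)).
exists (fun x => flat n.+2 x + - n%:R * flat n.+1 x); split.
  by move=> x; rewrite mulNr; exact: is_derive_flat.
by apply: smoothD => //; apply: smoothM => //; exact: smooth_cst.
Qed.

Definition bump (x : R) : R := flat 0 (1 * x + 1) * flat 0 (-1 * x + 1).

Lemma smooth_bump k : smooth k bump.
Proof. by apply: smoothM; apply: smooth_affine; exact: smooth_flat. Qed.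

Lemma flat_ge0 n x : 0 <= @flat R n x.
Proof.
by rewrite /flat; case: ifPn => // x0; rewrite mulr_ge0 ?expR_ge0// exprn_ge0// invr_ge0 ltW.
Qed.

Lemma bump_ge0 x : 0 <= bump x.
Proof. by rewrite mulr_ge0// flat_ge0. Qed.

Lemma bump_eq0 x : 1 <= `|x| -> bump x = 0.
Proof.
rewrite /bump /flat => x1; case: ifPn => h1; last by rewrite mul0r.
case: ifPn => h2; last by rewrite mulr0.
by move: x1; case: (leP 0 x) => x0; [rewrite ger0_norm//|rewrite ltr0_norm//]; lra.
Qed.

Lemma bump_gt0 x : `|x| < 1 -> 0 < bump x.
Proof.
rewrite ltr_norml => /andP[x1 x2]; rewrite /bump /flat !ifT; [|lra|lra].
by rewrite mulr_gt0// expr0 mul1r expR_gt0.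
Qed.

Lemma bump_min : exists2 c, 0 < c & forall x, `|x| <= 2^-1 -> c <= bump x.
Proof.
(* For |x| <= 1/2 both arguments 1 + x and 1 - x are at least 1/2. *)
exists (expR (- 2) * expR (- 2)); first by rewrite mulr_gt0// expR_gt0.
move=> x; rewrite ler_norml => /andP[x1 x2]; rewrite /bump /flat !ifT; [|lra|lra].
rewrite !expr0 !mul1r ler_pM ?expR_ge0// ler_expR lerN2 -[leRHS]invrK lef_pV2 ?posrE ?invr_gt0; lra.
Qed.

Lemma compact_support_bounded f (M : R) : continuous f ->
  (forall x, M < `|x| -> f x = 0) -> exists K, forall x, `|f x| <= K.
Proof.
move=> cf fM; exact: (Cc_boundedE (MkCc cf (compact_closure_neq0 fM))).
Qed.

Lemma bump_bounds : exists (b' : R -> R) (K : R),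
  [/\ forall x, is_derive x (1 : R) bump (b' x), forall x, 1 < `|x| -> b' x = 0,
      0 < K, forall x, `|bump x| <= K & forall x, `|b' x| <= K].
Proof.
have [b' [db sb]] := smooth_bump 1.
have b'0 x : 1 < `|x| -> b' x = 0.
  move=> x1; rewrite -(@derive_val _ _ _ _ _ _ _ (db x)).
  rewrite (@near_eq_derive _ _ _ _ (cst 0)) ?derive_cst//.
  have : `|y| @[y --> x] --> `|x| by exact: norm_continuous.
  move=> /(_ [set r | 1 < r]) h.
  have {}h := h (lt_nbhsr x1).
  by near=> y; apply: bump_eq0; apply: ltW; near: y; exact: h.
have [K1 bK1] : exists K, forall x, `|bump x| <= K.
  by apply: (@compact_support_bounded _ 1) => [|x x1]; [exact: (smooth_bump 0)|rewrite bump_eq0// ltW].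
have [K2 bK2] := compact_support_bounded sb b'0.
(* A common bound for the bump and its derivative; the 1 makes it positive. *)
exists b', (Num.max 1 (Num.max K1 K2)); split => //.
- by rewrite lt_max ltr01.
- by move=> x; rewrite !le_max bK1 orbT.
- by move=> x; rewrite !le_max bK2 !orbT.
Unshelve. all: by end_near. Qed.

Lemma is_derive_e1 f g (f' : R -> R) X : (forall x, is_derive x (1 : R) f (f' x)) ->
  is_derive X e1 (fun X : R * R => f X.1 * g X.2) (f' X.1 * g X.2).
Proof.
move=> df; apply: cvg_is_derive.
have [fd fv] := df X.1.
have : h^-1 *: ((f \o shift X.1) (h *: 1) - f X.1) @[h --> (0 : R)^'] --> f' X.1.
  by rewrite -fv; exact: fd.
move=> cf; rewrite (_ : (fun h : R => _) =
  (fun h : R => (h^-1 *: ((f \o shift X.1) (h *: 1) - f X.1)) * g X.2)).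
  by apply: cvgM => //; exact: cvg_cst.
apply/funext => h /=; rewrite [_ *: (0 : R)]mulr0 add0r.
by rewrite -mulrBl [in RHS]/GRing.scale/= [LHS]/GRing.scale/= mulrA.
Qed.

Lemma is_derive_e2 f g (g' : R -> R) X : (forall x, is_derive x (1 : R) g (g' x)) ->
  is_derive X e2 (fun X : R * R => f X.1 * g X.2) (f X.1 * g' X.2).
Proof.
move=> dg; apply: cvg_is_derive.
have [gd gv] := dg X.2.
have : h^-1 *: ((g \o shift X.2) (h *: 1) - g X.2) @[h --> (0 : R)^'] --> g' X.2.
  by rewrite -gv; exact: gd.
move=> cg; rewrite (_ : (fun h : R => _) =
  (fun h : R => f X.1 * (h^-1 *: ((g \o shift X.2) (h *: 1) - g X.2)))).
  by apply: cvgM => //; exact: cvg_cst.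
apply/funext => h /=; rewrite [_ *: (0 : R)]mulr0 add0r.
by rewrite -mulrBr [in RHS]/GRing.scale/= [LHS]/GRing.scale/= mulrCA.
Qed.

Lemma continuous_prod_fun f g : continuous f -> continuous g ->
  continuous (fun X : R * R => f X.1 * g X.2).
Proof.
move=> cf cg X; apply: cvgM.
  apply: (@cvg_comp _ _ _ (fun X : R * R => X.1) f _ (nbhs X.1)); last exact: cf.
  exact: cvg_fst.
apply: (@cvg_comp _ _ _ (fun X : R * R => X.2) g _ (nbhs X.2)); last exact: cg.
exact: cvg_snd.
Qed.

Lemma Ck_prod k f g : smooth k f -> smooth k g -> Ck k (fun X => f X.1 * g X.2).
Proof.
elim: k f g => [|k IH] f g sf sg.
  by split => //; exact: continuous_prod_fun.
have sf0 := smoothW sf; have sg0 := smoothW sg.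
split; first by apply: continuous_prod_fun; [exact: smooth_continuous sf|exact: smooth_continuous sg].
move: sf sg => [f' [df sf]] [g' [dg sg]].
have d1 X := is_derive_e1 g X df.
have d2 X := is_derive_e2 f X dg.
split.
- by move=> X; have [] := d1 X.
- by move=> X; have [] := d2 X.
- rewrite (_ : (fun X => _) = (fun X => f' X.1 * g X.2)); first exact: IH.
  by apply/funext => X; exact: derive_val.
- rewrite (_ : (fun X => _) = (fun X => f X.1 * g' X.2)); first exact: IH.
  by apply/funext => X; exact: derive_val.
Qed.

Lemma test_function_prod f g (M : R) : (forall k, smooth k f) -> (forall k, smooth k g) ->
  (forall x, M < `|x| -> f x = 0) -> (forall x, M < `|x| -> g x = 0) ->
  test_function (fun X => f X.1 * g X.2).
Proof.
move=> sf sg fM gM; split; first by move=> k; exact: Ck_prod.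
have cI : compact (`[- M, M] `*` `[- M, M] : set (R * R)).
  by apply: compact_setX; exact: segment_compact.
apply: (subclosed_compact _ cI); first exact: closed_closure.
have clI := compact_closed (@norm_hausdorff _ _) cI.
rewrite [X in _ `<=` X]((closure_id _).1 clI); apply: closure_subset => X /= fX.
by split; rewrite /= in_itv/= -ler_norml leNgt; apply/negP => Mx; move: fX;
  rewrite ?(fM _ Mx) ?(gM _ Mx) ?mul0r ?mulr0 eqxx.
Qed.

End test_functions.

(** * Flux out of a square *)

Section null_energy.
Context {R : realType}.
Local Notation leb := (@lebesgue_measure R).
Local Notation leb2 := (leb \x leb)%E.
Local Notation e1 := ((1 : R), (0 : R)).
Local Notation e2 := ((0 : R), (1 : R)).

(** If g has a finite integral, both parts of f have integrals between 0 and that value, which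
    bounds their difference; otherwise the bound is trivial. Thus f need not be shown integrable. *)
Lemma normr_Rintegral_le d (T : measurableType d) (mu : {measure set T -> \bar R})
    (f : T -> R) (g : T -> \bar R) : (forall x, `|f x|%:E <= g x)%E ->
  (`|\int[mu]_x f x|%R%:E <= \int[mu]_x g x)%E.
Proof.
move=> fg; rewrite /Rintegral integralE.
have a0 : (0 <= \int[mu]_x (EFin \o f)^\+ x)%E by apply: integral_ge0 => x _.
have b0 : (0 <= \int[mu]_x (EFin \o f)^\- x)%E by apply: integral_ge0 => x _.
have ag : (\int[mu]_x (EFin \o f)^\+ x <= \int[mu]_x g x)%E.
  apply: le_lower_integral => // x; apply: le_trans (fg x).
  by rewrite funeposE ge_max !lee_fin normr_ge0 ler_norm.
have bg : (\int[mu]_x (EFin \o f)^\- x <= \int[mu]_x g x)%E.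
  apply: le_lower_integral => // x; apply: le_trans (fg x).
  by rewrite funenegE ge_max !lee_fin normr_ge0 -normrN ler_norm.
have [gfin|] := boolP (\int[mu]_x g x \is a fin_num)%E; last first.
  rewrite ge0_fin_numE ?(le_trans a0)// -leNgt leye_eq => /eqP ->.
  by rewrite leey.
move: gfin a0 b0 ag bg; case: (\int[mu]_x g x)%E => [c| |]// _.
move=> a0 b0 ag bg.
have /bounded_fine[a -> /andP[a0' ac]] := introT andP (conj a0 ag).
have /bounded_fine[b -> /andP[b0' bc]] := introT andP (conj b0 bg).
by rewrite lee_fin/= ler_norml; apply/andP; split; lra.
Qed.

(** Integrated, with d left free, it does the work of Cauchy-Schwarz and stays meaningful when the
    energy is infinite. *)
Lemma amgm (a p d : R) : 0 < d -> `|a * p| <= d / 2 * a ^+ 2 + p ^+ 2 / (2 * d).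
Proof.
move=> d0; rewrite -subr_ge0.
have -> : d / 2 * a ^+ 2 + p ^+ 2 / (2 * d) - `|a * p| = (d * `|a| - `|p|) ^+ 2 / (2 * d).
  rewrite normrM -[a ^+ 2]real_normK ?num_real// -[p ^+ 2]real_normK ?num_real//.
  by field; rewrite gt_eqF.
by rewrite divr_ge0 ?sqr_ge0// mulr_ge0// ltW.
Qed.

Lemma enorm2 (X : R * R) : enorm X ^+ 2 = X.1 ^+ 2 + X.2 ^+ 2.
Proof. by rewrite /enorm sqr_sqrtr// addr_ge0// sqr_ge0. Qed.

Lemma measurable_enorm2 (E : R * R -> R * R) : measurable_fun setT E ->
  measurable_fun setT (fun X => enorm (E X) ^+ 2).
Proof.
move=> mE; rewrite (_ : (fun X => _) = (fun X => (E X).1 ^+ 2 + (E X).2 ^+ 2)); last first.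
  by apply/funext => X; rewrite enorm2.
apply: measurable_funD; apply: measurable_funX.
- exact: (measurableT_comp measurable_fst mE).
- exact: (measurableT_comp measurable_snd mE).
Qed.

(* Test the equation against bump(x/L) bump(y/L), whose gradient is O(1/L) on a
   square of area 4 L^2, and split E . grad phi by AM-GM with weight d. *)
Lemma strip_flux : exists c K : R, [/\ 0 < c, 0 < K &
  forall gamma E, null_conf gamma -> measurable_fun setT E -> div_compatible gamma E ->
  forall L d, 0 < L -> 0 < d ->
  ((c * L)%:E <= (d / 2)%:E * \int[leb2]_(X in strip L) (enorm (E X) ^+ 2)%:E + (K / d)%:E)%E].
Proof.
have [b' [K [db b'0 K0 bK b'K]]] := @bump_bounds R.
have [c0 c00 bc] := @bump_min R.
have b00 : 0 < bump (0 : R) by apply: bump_gt0; rewrite normr0.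
(* The rescaled bump is at least [c0] on an interval of length L, whence the first constant. The
   second is the gradient bound (K^2 / L)^2 times the area 4 L^2. *)
exists (2 * pi * (bump 0 * c0)), (4 * K ^+ 4); split.
- by apply: mulr_gt0; [rewrite mulr_gt0 ?pi_gt0|exact: mulr_gt0].
- by rewrite mulr_gt0// exprn_gt0.
move=> gamma E gamma0 mE divE L d L0 d0.
pose f (x : R) := bump (L^-1 * x + 0).
have fE x : f x = bump (x / L) by rewrite /f addr0 mulrC.
pose f' (x : R) := b' (L^-1 * x + 0) * L^-1.
have f'E x : f' x = b' (x / L) / L by rewrite /f' addr0 [_ * x]mulrC.
have df x : is_derive x (1 : R) f (f' x).
  apply: (@is_derive1_comp _ bump (fun x => L^-1 * x + 0)).
  by apply: is_derive_eq; rewrite addr0; exact: mulr1.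
have normL x : `|x / L| = `|x| / L by rewrite normrM normfV (gtr0_norm L0).
have f0 x : L < `|x| -> f x = 0.
  by move=> Lx; rewrite fE bump_eq0// normL ler_pdivlMr// mul1r ltW.
have f'0 x : L < `|x| -> f' x = 0.
  by move=> Lx; rewrite f'E b'0 ?mul0r// normL ltr_pdivlMr// mul1r.
have sf k : smooth k f by apply: smooth_affine; exact: smooth_bump.
have tphi := test_function_prod sf sf f0 f0.
have := divE _ tphi.
rewrite Rint_null// sub0r.
have -> : (fun X => (E X).1 * 'D_e1 (fun X : R * R => f X.1 * f X.2) X +
    (E X).2 * 'D_e2 (fun X : R * R => f X.1 * f X.2) X) =
    (fun X => (E X).1 * (f' X.1 * f X.2) + (E X).2 * (f X.1 * f' X.2)).
  apply/funext => X; rewrite (@derive_val _ _ _ _ _ _ _ (is_derive_e1 f X df)).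
  by rewrite (@derive_val _ _ _ _ _ _ _ (is_derive_e2 f X df)).
move=> divphi.
have f00 : f 0 = bump 0 by rewrite /f mulr0 addr0.
have h0 x : 0 <= f x * f 0 by rewrite /f mulr_ge0 ?bump_ge0.
have intphi : c0 * bump 0 * L <= \int[leb]_x (f x * f 0).
  have lo : ((c0 * bump 0 * L)%:E <= \int[leb]_x (f x * f 0)%:E)%E.
    pose D : set (measurableTypeR R) := `[- (L / 2), L / 2]%classic.
    apply: (@le_trans _ _ (\int[leb]_(x in D) (cst (c0 * bump 0)%:E x))%E).
      rewrite integral_cst//; last exact: measurable_itv.
      rewrite /= /D lebesgue_measure_itv/= lte_fin ifT; last by lra.
      by rewrite -EFinD -EFinM lee_fin opprK -splitr.
    rewrite integral_mkcond; apply: le_lower_integral => x; rewrite patchE.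
      by case: ifPn => // _; rewrite lee_fin mulr_ge0// ltW.
    case: ifPn => [|_]; rewrite lee_fin//.
    rewrite inE /D/= in_itv/= -ler_norml => xL.
    rewrite f00 ler_wpM2r ?bump_ge0// fE bc// normL ler_pdivrMr// mulrC.
    exact: xL.
  (* The real-valued integral sends an infinite value to 0, so finiteness is required before the
     lower bound can be transferred. *)
  have hi : (\int[leb]_x (f x * f 0)%:E < +oo)%E.
    pose D : set (measurableTypeR R) := `[- L, L]%classic.
    apply: (@le_lt_trans _ _ (\int[leb]_(x in D) (cst (K * K)%:E x))%E).
      rewrite [leRHS]integral_mkcond; apply: le_lower_integral => x; first by rewrite lee_fin.
      rewrite patchE; case: ifPn => [_|].
        rewrite lee_fin -[leLHS]ger0_norm// normrM ler_pM//; exact: bK.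
      rewrite notin_setE /D/= in_itv/= => /negP; rewrite -ler_norml -ltNge => xL.
      by rewrite f0// mul0r.
    rewrite integral_cst//; last exact: measurable_itv.
    rewrite /= /D lebesgue_measure_itv/= lte_fin ifT; last by lra.
    by rewrite -EFinD -EFinM ltry.
  rewrite /Rintegral -lee_fin fineK// ge0_fin_numE//.
  by apply: integral_ge0 => x _; rewrite lee_fin.
apply: (@le_trans _ _ `|\int[leb2]_X ((E X).1 * (f' X.1 * f X.2) + (E X).2 * (f X.1 * f' X.2))|%:E)%R.
  rewrite lee_fin divphi mulrN normrN normrM ger0_norm ?mulr_ge0 ?pi_ge0//.
  rewrite -(mulrA (2 * pi)) ler_wpM2l ?mulr_ge0 ?pi_ge0//.
  apply: le_trans (ler_norm _); apply: le_trans intphi.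
  by rewrite (mulrC (bump 0)).
pose m := K ^+ 2 / L.
pose B : set (R * R) := `[- L, L] `*` `[- L, L].
have mB : measurable B by apply: measurableX; exact: measurable_itv.
pose g X := (d / 2 * enorm (E X) ^+ 2 + m ^+ 2 / d)%:E.
apply: (@le_trans _ _ (\int[leb2]_(X in B) g X)%E).
  rewrite integral_mkcond; apply: normr_Rintegral_le => X.
  have pm (x y : R) : (f' x * f y) ^+ 2 <= m ^+ 2.
    rewrite -[_ ^+ 2]real_normK ?num_real// lerXn2r ?nnegrE ?normr_ge0//.
      by rewrite divr_ge0 ?sqr_ge0// ltW.
    rewrite normrM f'E normrM normfV (gtr0_norm L0) /m expr2 mulrAC ler_wpM2r ?invr_ge0 ?(ltW L0)//.
    by rewrite ler_pM// fE.
  rewrite patchE; case: ifPn => [_|].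
    rewrite lee_fin enorm2; apply: le_trans (ler_normD _ _) _.
    apply: le_trans (lerD (amgm _ _ d0) (amgm _ _ d0)) _.
    have h1 : (f' X.1 * f X.2) ^+ 2 / (2 * d) <= m ^+ 2 / (2 * d).
      by rewrite ler_wpM2r// invr_ge0 mulr_ge0// ltW.
    have h2 : (f X.1 * f' X.2) ^+ 2 / (2 * d) <= m ^+ 2 / (2 * d).
      by rewrite mulrC [f _ * _]mulrC mulrC ler_wpM2r// invr_ge0 mulr_ge0// ltW.
    have -> : m ^+ 2 / d = m ^+ 2 / (2 * d) + m ^+ 2 / (2 * d) by field; rewrite gt_eqF.
    move: h1 h2; set u := _ / _; set v := _ / _; set w := _ / (2 * d) => h1 h2; lra.
  rewrite notin_setE /B/= => /not_andP nB.
  suff [e_1 e_2] : f' X.1 * f X.2 = 0 /\ f X.1 * f' X.2 = 0 by rewrite e_1 e_2 !mulr0 addr0 normr0.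
  case: nB => /negP; rewrite in_itv/= -ler_norml -ltNge => XL.
    by rewrite (f0 _ XL) (f'0 _ XL) !mul0r.
  by rewrite (f0 _ XL) (f'0 _ XL) !mulr0.
have mE2 : measurable_fun setT (fun X => (enorm (E X) ^+ 2)%:E).
  by apply/measurable_EFinP; exact: measurable_enorm2.
rewrite (@ge0_integralD _ _ _ leb2 B mB
  (fun X => (d / 2 * enorm (E X) ^+ 2)%:E) (fun X => (m ^+ 2 / d)%:E)); last first.
- exact: measurable_cst.
- by move=> X _; rewrite lee_fin divr_ge0 ?sqr_ge0// ltW.
- apply/measurable_EFinP; apply: measurable_funM; first exact: measurable_cst.
  by apply: measurable_funTS; exact: measurable_enorm2.
- by move=> X _; rewrite lee_fin mulr_ge0 ?sqr_ge0// divr_ge0// ltW.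
apply: leeD.
  have -> : (\int[leb2]_(X in B) (d / 2 * enorm (E X) ^+ 2)%:E =
      (d / 2)%:E * \int[leb2]_(X in B) (enorm (E X) ^+ 2)%:E)%E.
    apply: (@ge0_integralZl_EFin _ _ R leb2 B mB (fun X => (enorm (E X) ^+ 2)%:E)).
    - by move=> X _; rewrite lee_fin sqr_ge0.
    - by apply: measurable_funTS.
    - by rewrite divr_ge0// ltW.
  rewrite lee_wpmul2l ?lee_fin ?divr_ge0 ?(ltW d0)//.
  apply: ge0_subset_integral => //.
  - by apply: measurableX => //; exact: measurable_itv.
  - by apply: measurable_funTS.
  - by move=> X _; rewrite lee_fin sqr_ge0.
  - by move=> X [].
have lebB : leb2 B = ((2 * L) * (2 * L))%:E.
  pose D : set (measurableTypeR R) := `[- L, L]%classic.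
  transitivity (leb D * leb D)%E.
    by apply: product_measure1E; exact: measurable_itv.
  rewrite /D lebesgue_measure_itv/= lte_fin ifT; last by lra.
  by rewrite -EFinD -EFinM opprK; congr (_%:E); ring.
apply: (@le_trans _ _ ((m ^+ 2 / d)%:E * leb2 B)%E); first by rewrite integral_cst.
rewrite lebB -EFinM lee_fin /m le_eqVlt; apply/orP; left; apply/eqP.
by field; rewrite !gt_eqF.
Qed.

End null_energy.

(** * Divergence of the energy *)

Section null_Wdiv.
Context {R : realType}.
Local Notation leb := (@lebesgue_measure R).
Local Notation leb2 := (leb \x leb)%E.

Lemma Etrunc_null (gamma : Conf R) E eps X : null_conf gamma -> Etrunc gamma E eps X = E X.
Proof.
move=> g0; rewrite [RHS]surjective_pairing /Etrunc.
by congr (_, _); rewrite Rint_null// subr0.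
Qed.

(** Without points truncation does not change E. A limsup below +oo would bound the energy in the
    strip linearly in L, against the quadratic growth forced by [strip_flux]. *)
Lemma strip_energy_null_limsup (q eps : R) (gamma : Conf R) E : null_conf gamma ->
  Lq_loc q E -> div_compatible gamma E ->
  limf_esup (strip_energy gamma E eps) (pinfty_nbhs R) = +oo%E.
Proof.
move=> g0 [mE _] divE; apply/eqP; rewrite -leye_eq leNgt; apply/negP => lim_lt.
have [_ [V [L0 [_ VL0]] <-] supV] := ereal_inf_lt lim_lt.
have [M supM] : exists M : R, (ereal_sup (strip_energy gamma E eps @` V) <= M%:E)%E.
  case: (ereal_sup _) supV => [r _|//|_]; first by exists r.
  by exists 0; rewrite leNye.
have [c [K [c0 K0 flux]]] := @strip_flux R.
pose S L := (\int[leb2]_(X in strip L) (enorm (E X) ^+ 2)%:E)%E.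
(* Undoing the normalization 1 / (2 L) and 1 / (2 pi) produces 4 pi L; the added 1 keeps C
   positive. *)
pose C := `|M - ln eps| * (4 * pi) + 1.
have pi0 := pi_gt0 R.
have C0 : 0 < C by rewrite ltr_pwDr// mulr_ge0// mulr_ge0// ltW.
have SC L : 0 < L -> L0 < L -> 1 <= L -> (S L <= (C * L)%:E)%E.
  move=> Lpos LL0 L1.
  have : (strip_energy gamma E eps L <= M%:E)%E.
    by apply: le_trans supM; apply: ereal_sup_ubound; exists L => //; exact: VL0.
  rewrite /strip_energy.
  rewrite (_ : (\int[leb2]_(X in strip L) _)%E = S L); last first.
    by apply: eq_integral => X _; rewrite Etrunc_null.
  rewrite -leeBrDr// -EFinB -lee_pdivlMl; last first.
    by rewrite mulr_gt0// invr_gt0 mulr_gt0.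
  move=> /le_trans; apply; rewrite -EFinM lee_fin invfM !invrK.
  apply: (@le_trans _ _ (`|M - ln eps| * (4 * pi) * L)); last first.
    by rewrite /C ler_wpM2r ?(ltW Lpos)// lerDl.
  have -> : 2 * L * (2 * pi) * (M - ln eps) = (M - ln eps) * (4 * pi) * L by ring.
  by rewrite ler_wpM2r ?(ltW Lpos)// ler_wpM2r ?mulr_ge0 ?(ltW pi0)// ler_norm.
(* With weight d = c / C the two terms of the flux bound are at most c L / 2 and, by the last entry
   of the maximum, c L / 4; together they stay below c L. *)
pose L := Num.max (L0 + 1) (Num.max 1 (4 * K * C / c ^+ 2)).
have LL0 : L0 < L by rewrite lt_max ltrDl ltr01.
have L1 : 1 <= L by rewrite !le_max lexx orbT.
have L2 : 4 * K * C / c ^+ 2 <= L by rewrite !le_max lexx !orbT.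
have Lpos : 0 < L by exact: lt_le_trans L1.
have d0 : 0 < c / C by rewrite divr_gt0.
have := flux gamma E g0 mE divE L (c / C) Lpos d0; apply/negP; rewrite -ltNge.
apply: (@le_lt_trans _ _ ((c / C / 2)%:E * (C * L)%:E + (K / (c / C))%:E)%E).
  rewrite leeD2r// lee_wpmul2l; [by []| |exact: SC].
  by rewrite lee_fin ltW// divr_gt0.
rewrite -EFinM -EFinD lte_fin.
have -> : c / C / 2 * (C * L) = c * L / 2 by field; rewrite gt_eqF.
have -> : K / (c / C) = K * C / c by field; rewrite !gt_eqF.
have h : 4 * (K * C / c) <= c * L.
  rewrite -ler_pdivrMl//; apply: le_trans L2; rewrite le_eqVlt; apply/orP; left; apply/eqP.
  by field; rewrite gt_eqF.
have h2 : 0 < c * L by rewrite mulr_gt0.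
by move: h h2; set a := _ / c; set b := c * L; lra.
Qed.

Lemma Wdiv_conf_null (q : R) (gamma : Conf R) : null_conf gamma -> Wdiv_conf q gamma = +oo%E.
Proof.
move=> g0; apply/eqP; rewrite -leye_eq; apply: le_ereal_inf_tmp => w [E [LE divE Ew]].
have lim_oo : (fun eps => limf_esup (strip_energy gamma E eps) (pinfty_nbhs R)) = cst +oo%E.
  by apply/funext => eps; exact: strip_energy_null_limsup g0 LE divE.
rewrite lim_oo in Ew.
by rewrite (cvg_unique (@ereal_hausdorff R) Ew (cvg_cst _)).
Qed.

(** The uniform lower bound keeps the integral of the negative part finite, so the infinite positive
    part decides. Applied to the mixture it gives the infinite energy; contraposed for Sine, the
    negligibility of [null_conf]. *)
Lemma Wdiv_null (q : R) (P : probability (Conf R) R) :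
  (exists c : R, forall gamma : Conf R, (c%:E <= Wdiv_conf q gamma)%E) ->
  (0 < P (@null_conf R))%E -> Wdiv q P = +oo%E.
Proof.
move=> [c cW] P0; rewrite /Wdiv integralE.
have hn : (0 <= \int[P]_g (Wdiv_conf q)^\- g <= `|c|%:E)%E.
  apply: lower_integral_bounded => g; rewrite funenegE le_max lexx orbT ge_max lee_fin normr_ge0 andbT.
  rewrite leeNl; apply: le_trans (cW g); rewrite -EFinN lee_fin.
  by rewrite lerNl -normrN ler_norm.
have [r -> _] := bounded_fine hn.
suff -> : (\int[P]_g (Wdiv_conf q)^\+ g = +oo)%E by [].
apply/eqP; rewrite -leye_eq; apply: (@le_trans _ _ (\int[P]_(g in @null_conf R) cst +oo g)%E).
  by rewrite integral_cst ?gt0_mulye//; exact: measurable_null_conf.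
rewrite integral_mkcond; apply: le_lower_integral => g; rewrite patchE; case: ifPn => //.
- by move=> _; exact: leey.
- by rewrite inE => g0 /=; rewrite funeposE Wdiv_conf_null// le_max lexx.
- by move=> _; exact: funepos_ge0.
Qed.

End null_Wdiv.

(** * Stationarity, intensity and conclusion *)

Section mixture_properties.
Context {R : realType}.
Variable P : probability (Conf R) R.
Local Notation Pmix := (mix (compressed2 P)).

Lemma stationary_mix : stationary P -> stationary Pmix.
Proof.
move=> sP t A mA; rewrite [LHS]mixE [RHS]mixE.
have -> : @comp2 R @^-1` (shiftconf t @^-1` A) = shiftconf (t * 2) @^-1` (@comp2 R @^-1` A).
  by apply/seteqP; split => g /=; rewrite shiftconf_comp2.
rewrite sP; last by rewrite -[X in measurable X]setTI; exact: measurable_comp2.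
congr (_ * _ + _)%E; rewrite !diracE; congr (_%:R%:E); congr nat_of_bool.
have -> : (emptyconf \in shiftconf t @^-1` A) = (shiftconf t emptyconf \in A).
  by apply/idP/idP; rewrite !inE.
suff -> : shiftconf t (@emptyconf R) = emptyconf by [].
exact: conf_ext.
Qed.

Lemma has_intensity_mix : has_intensity 1 P -> has_intensity 1 Pmix.
Proof.
move=> iP A mA bA.
rewrite lower_integral_mix//; last by move=> g g0; rewrite (null_confE mA g0).
rewrite mule0 add0e.
have mA2 : measurable ((fun x : measurableTypeR R => x / 2 : measurableTypeR R) @^-1` A).
  by rewrite -[X in measurable X]setTI; exact: measurable_half.
have := iP _ mA2 (bounded_half bA); rewrite mul1e => e.
rewrite [X in (_ * X)%E](_ : _ = lebesgue_measure ((fun x : R => x / 2) @^-1` A)); last exact: e.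
by rewrite lebesgue_measure_half// muleA -EFinM mulVf.
Qed.

End mixture_properties.

Theorem proposition9p4 (R : realType) (beta q : R)
    (beta_gt0 : 0 < beta) (q_bounds : 1 < q < 2)
    (* the process Sine_beta, with the known facts about it *)
    (Sine : probability (Conf R) R)
    (SineP : is_sine beta Sine)
    (Sine_stationary : stationary Sine)
    (Sine_intensity : has_intensity 1 Sine)
    (Sine_DLR : canonical_DLR beta Sine)
    (Sine_energy : (Wdiv q Sine < +oo)%E)
    (* the electric energy is bounded below by a universal constant *)
    (Wdiv_conf_lb : exists c : R, forall gamma : Conf R,
       (c%:E <= Wdiv_conf q gamma)%E) :
  let Pmix := mix (compressed2 Sine) in
  [/\ stationary Pmix,
      {ae Pmix, forall gamma, simple_conf gamma},
      has_intensity 1 Pmix,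
      canonical_DLR beta Pmix &
      ~ (forall A : set (Conf R), measurable A -> Pmix A = Sine A) /\
      Wdiv q Pmix = +oo%E].
Proof.
move=> Pmix.
have Sine0 : Sine (@null_conf R) = 0%E.
  apply/eqP/negPn/negP => S0; have := Wdiv_null Wdiv_conf_lb (P := Sine).
  rewrite lt0e S0 measure_ge0 => /(_ isT) e.
  by move: Sine_energy; rewrite e ltxx.
have Pmix0 : (0 < Pmix (@null_conf R))%E.
  rewrite [Pmix _]mixE diracE mem_set// mule1 (@lt_le_trans _ _ (2^-1)%:E)//.
  by rewrite leeDl// mule_ge0.
have dlr := canonical_DLR_mix Sine0 Sine_DLR.
split.
- exact: stationary_mix.
- exact: canonical_DLR_simple beta_gt0 dlr.
- exact: has_intensity_mix.
- exact: dlr.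
- split; last exact: Wdiv_null Wdiv_conf_lb Pmix0.
  move=> PS; move: Pmix0; rewrite PS ?Sine0 ?ltxx//.
  exact: measurable_null_conf.
Qed.
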